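(* Let $q(m,n)=am^2+bmn+cn^2$ be an indefinite integral binary quadratic form whose discriminant $\Delta(q)=b^2-4ac>0$ is not a perfect square. Let $1\le p\le\infty$ and $\lambda>0$. For $f:\mathbb{Z}\to\mathbb{C}$ define $$\mathcal{I}_{\lambda}f(n)=\sum_{m\in\mathbb{Z}\setminus\{0\}}\frac{f(q(m,n))}{|m|^{\lambda}},\qquad n\in\mathbb{Z}.$$ If either $p<\infty$ and $\lambda>1-p^{-1}$, or $p=\infty$ and $\lambda>1$, then there is a constant $C_{p,\lambda,\Delta(q)}$ depending only on $p,\lambda,\Delta(q)$ such that for all $f\in\ell^p(\mathbb{Z})$, $$\|\mathcal{I}_{\lambda}f\|_{\ell^p(\mathbb{Z})}\le C_{p,\lambda,\Delta(q)}\|f\|_{\ell^p(\mathbb{Z})}.$$ Moreover this is sharp in the following sense: (i) For every $r\in\mathbb{N}$ there exist an indefinite integral binary quadratic form $q$ with nonsquare discriminant and a nonnegative $f\in\ell^1(\mathbb{Z})$ such that $\|\mathcal{I}_{\log^r}f\|_{\ell^1}=\infty$, where $\mathcal{I}_{\log^r}f(n)=\sum_{m\in\mathbb{Z}\setminus\{0\}}\frac{f(q(m,n))}{\log^r(1+|m|)}$. (ii) For every $1<p<\infty$ there exist an indefinite integral binary quadratic form $q$ with nonsquare discriminant and a nonnegative $f\in\ell^p(\mathbb{Z})$ such that $\|\mathcal{I}_{1-p^{-1}}f\|_{\ell^p}=\infty$. (iii) For $p=\infty$ there exist an indefinite integral binary quadratic form $q$ with nonsquare discriminant and a nonnegative $f\in\ell^\infty(\mathbb{Z})$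 such that $\|\mathcal{I}_{1}f\|_{\ell^\infty}=\infty$.
   Context: An integral binary quadratic form is $q(m,n)=am^2+bmn+cn^2$ with $a,b,c\in\mathbb{Z}$, evaluated at integers $m,n$; its discriminant is $\Delta(q)=b^2-4ac$. It is called indefinite if $\Delta(q)>0$. For nonnegative $f$ the sums defining the operators are sums of nonnegative terms and are allowed to equal $+\infty$. *)

(* Defs.v *)
From Stdlib Require Import Reals ZArith Classical ClassicalEpsilon.
Open Scope R_scope.

Inductive Rbar : Type := Fin (r : R) | PInf.

Definition Rbar_plus (x y : Rbar) : Rbar :=
  match x, y with Fin a, Fin b => Fin (a + b) | _, _ => PInf end.

(** x^e for x >= 0, e > 0 (with 0^e = 0). *)
Definition rpow (x e : R) : R := if Rlt_dec 0 x then Rpower x e else 0.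

Definition Rbar_rpow (x : Rbar) (e : R) : Rbar :=
  match x with Fin a => Fin (rpow a e) | PInf => PInf end.

Definition Rsup (E : R -> Prop) : Rbar :=
  match excluded_middle_informative (bound E /\ exists x, E x) with
  | left H => Fin (proj1_sig (completeness E (proj1 H) (proj2 H)))
  | right _ => PInf
  end.

Definition Rbar_sup (E : Rbar -> Prop) : Rbar :=
  match excluded_middle_informative (E PInf) with
  | left _ => PInf
  | right _ => Rsup (fun x => E (Fin x))
  end.

Fixpoint symsum (g : Z -> Rbar) (N : nat) : Rbar :=
  match N with
  | O => g 0%Z
  | S k => Rbar_plus (symsum g k)
             (Rbar_plus (g (Z.of_nat (S k))) (g (- Z.of_nat (S k))%Z))
  end.

(** Sum over Z of a nonnegative (extended-real) family, possibly +infinity. *)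
Definition sumZ (g : Z -> Rbar) : Rbar :=
  Rbar_sup (fun x => exists N, x = symsum g N).

Inductive Exponent : Type := ExpFin (p : R) | ExpInf.

Definition lpnormE (p : Exponent) (g : Z -> Rbar) : Rbar :=
  match p with
  | ExpFin p0 => Rbar_rpow (sumZ (fun k => Rbar_rpow (g k) p0)) (/ p0)
  | ExpInf => Rbar_sup (fun x => exists k, x = g k)
  end.

Definition Cx : Type := (R * R)%type.
Definition Cmod (z : Cx) : R := sqrt (fst z ^ 2 + snd z ^ 2).

Definition lpnorm (p : Exponent) (f : Z -> Cx) : Rbar :=
  lpnormE p (fun k => Fin (Cmod (f k))).

Definition qform (a b c m n : Z) : Z := (a * m * m + b * m * n + c * n * n)%Z.
Definition qdisc (a b c : Z) : Z := (b * b - 4 * a * c)%Z.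

Definition indef_nonsquare (a b c : Z) : Prop :=
  (0 < qdisc a b c)%Z /\ ~ (exists k : Z, (k * k)%Z = qdisc a b c).

(** Weights 1/|m|^lambda and 1/log^r(1+|m|) (used only for m <> 0). *)
Definition wpow (lam : R) (m : Z) : R := / Rpower (IZR (Z.abs m)) lam.
Definition wlog (r : nat) (m : Z) : R := / (ln (1 + IZR (Z.abs m))) ^ r.

Definition IopE (w : Z -> R) (a b c : Z) (f : Z -> R) (n : Z) : Rbar :=
  sumZ (fun m => if Z.eq_dec m 0 then Fin 0 else Fin (f (qform a b c m n) * w m)).

Definition Rlim (u : nat -> R) : R :=
  match excluded_middle_informative (exists l, Un_cv u l) with
  | left H => proj1_sig (constructive_indefinite_description _ H)
  | right _ => 0
  end.

Fixpoint rsymsum (g : Z -> R) (N : nat) : R :=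
  match N with
  | O => g 0%Z
  | S k => rsymsum g k + (g (Z.of_nat (S k)) + g (- Z.of_nat (S k))%Z)
  end.

Definition Iop (w : Z -> R) (a b c : Z) (f : Z -> Cx) (n : Z) : Cx :=
  let t := fun m : Z => if Z.eq_dec m 0 then (0, 0)
                        else (w m * fst (f (qform a b c m n)),
                              w m * snd (f (qform a b c m n))) in
  (Rlim (rsymsum (fun m => fst (t m))), Rlim (rsymsum (fun m => snd (t m)))).

(* Main.v *)
Require Import Defs.
From Stdlib Require Import Reals ZArith.
From Stdlib Require Import Znumtheory List FinFun Lra Lia Psatz.
From Stdlib Require Import FunctionalExtensionality Classical ClassicalEpsilon.
Import ListNotations.
Open Scope R_scope.

(** Boundedness. With [x = 2 c n + b m], the equation [q (m, n) = k] becomes [x^2 - D m^2 = K],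
    [K = 4 c k], so the case [p = 1] is a bound, uniform in [K], for the sum of [|m|^-mu] over all
    solutions with [m <> 0]. In a dyadic block [|m| ~ M] with [|K| << M^4] there are [O(M^eps)]
    solutions: the primitive ones fall into at most [d(K)] classes (by the gcd of
    [x m0 - x0 m] and [K], for a fixed solution [(x0, m0)]); in a class [x m' - x' m] is almost
    a multiple of [K] while being [O(K)], so a class has boundedly many members; and
    [d(K) = O(|K|^eps)]. If [K >> M^4] the block has at most four solutions. Jensen's inequality
    reduces the case [1 < p < oo] to [p = 1], and [p = oo] is trivial.

    Sharpness, with [q = m^2 - 2 n^2]. For [p > 1] the single value [n = 0] suffices. For [p = 1],
    a fixed number [s = r + 3] of elements [1 + y_i sqrt 2] of coprime norms [n_i] gives
    [(t + 1)^s] solutions of [q = (n_1 ... n_s)^t], all with [log |m| = O(t)]; take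
    [f = 1 / t^2] there. *)

(** * Finite sums and cardinality bounds *)

(** The equation [x^2 - D m^2 = K] may have infinitely many solutions, because units act on them;
    what can be bounded uniformly in [K] is their number in a dyadic block. Inside a block, two
    solutions [s] and [s'], read as [x + m sqrt D], are compared through
    [s conj(s') = U - W sqrt D], of norm [K^2]: the block bounds [W], the class makes [W] nearly a
    multiple of [K], and [U], [W], [s'] determine [s]. The dichotomy at [M^4] comes from the divisor
    bound. It yields [|K|^eps], which helps only while [|K|] is at most a power of [M]; beyond that,
    uniformity in [K] needs another reason. The power 4 is where [sqrt K] reaches the size [D M^2]
    of the variation of [D m^2] over a block. Negative [K] always lies in the first range, as
    [-K <= D m^2]. That [D] is not a square gives both [K <> 0] when [m <> 0] and [c <> 0]. The
    coefficients enter only through the injective substitution for [x], so the constant depends on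
    [D] alone. For sharpness at [p = 1] one form serves every [r], since there are arbitrarily many
    pairwise coprime norms [1 - 2 y^2]. *)

Definition lsum {A : Type} (f : A -> R) (l : list A) : R :=
  fold_right (fun x s => f x + s) 0 l.

Lemma lsum_le {A : Type} (f g : A -> R) (l : list A) :
  (forall x, In x l -> f x <= g x) -> lsum f l <= lsum g l.
Proof.
  induction l as [|a l IH]; simpl; intros H; [lra|].
  assert (f a <= g a) by auto. assert (lsum f l <= lsum g l) by auto. lra.
Qed.

Lemma lsum_ext {A : Type} (f g : A -> R) (l : list A) :
  (forall x, In x l -> f x = g x) -> lsum f l = lsum g l.
Proof.
  intros H. apply Rle_antisym; apply lsum_le; intros x Hx; rewrite (H x Hx); lra.
Qed.

Lemma lsum_const {A : Type} (c : R) (l : list A) :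
  lsum (fun _ => c) l = INR (length l) * c.
Proof.
  induction l as [|a l IH]; [simpl; lra|].
  simpl length. rewrite S_INR. simpl. rewrite IH. lra.
Qed.

Lemma lsum_nonneg {A : Type} (f : A -> R) (l : list A) :
  (forall x, In x l -> 0 <= f x) -> 0 <= lsum f l.
Proof.
  intros H. replace 0 with (lsum (fun _ : A => 0) l) by (rewrite lsum_const; ring).
  now apply lsum_le.
Qed.

Lemma lsum_plus {A : Type} (f g : A -> R) (l : list A) :
  lsum (fun x => f x + g x) l = lsum f l + lsum g l.
Proof. induction l as [|a l IH]; simpl; lra. Qed.

Lemma lsum_scal {A : Type} (c : R) (f : A -> R) (l : list A) :
  lsum (fun x => c * f x) l = c * lsum f l.
Proof. induction l as [|a l IH]; simpl; [|rewrite IH]; lra. Qed.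

Lemma lsum_app {A : Type} (f : A -> R) (l l' : list A) :
  lsum f (l ++ l') = lsum f l + lsum f l'.
Proof. induction l as [|a l IH]; simpl; lra. Qed.

Lemma lsum_map {A B : Type} (f : B -> R) (h : A -> B) (l : list A) :
  lsum f (map h l) = lsum (fun x => f (h x)) l.
Proof. induction l as [|a l IH]; simpl; lra. Qed.

Lemma lsum_incl {A : Type} (f : A -> R) (l l' : list A) :
  NoDup l -> incl l l' -> (forall x, In x l' -> 0 <= f x) -> lsum f l <= lsum f l'.
Proof.
  intros Hl; revert l'. induction Hl as [|a l Ha Hl IH]; intros l' Hi Hf.
  - now apply lsum_nonneg.
  - destruct (in_split a l') as (l1 & l2 & ->); [apply Hi; now left|].
    rewrite lsum_app. simpl.
    assert (lsum f l <= lsum f (l1 ++ l2)).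
    { apply IH.
      - intros x Hx. assert (Hx' : In x (l1 ++ a :: l2)) by (apply Hi; now right).
        apply in_app_iff in Hx'. apply in_app_iff. destruct Hx' as [?|[?|?]]; auto.
        subst x. contradiction.
      - intros x Hx. apply Hf. apply in_app_iff in Hx. apply in_app_iff. simpl. tauto. }
    rewrite lsum_app in H. lra.
Qed.

Lemma lsum_list_prod {A B : Type} (f : A * B -> R) (l : list A) (l' : list B) :
  lsum f (list_prod l l') = lsum (fun x => lsum (fun y => f (x, y)) l') l.
Proof.
  induction l as [|a l IH]; simpl; [reflexivity|].
  rewrite lsum_app, lsum_map, IH. reflexivity.
Qed.

Definition classical_eqb {A : Type} (x y : A) : bool :=
  if excluded_middle_informative (x = y) then true else false.

Lemma classical_eqb_true {A : Type} (x y : A) : classical_eqb x y = true <-> x = y.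
Proof. unfold classical_eqb. destruct excluded_middle_informative; split; congruence. Qed.

Lemma eq_dec_classic {A : Type} (x y : A) : {x = y} + {x <> y}.
Proof. apply excluded_middle_informative. Qed.

Lemma lsum_filter_partition {A : Type} (f : A -> R) (t : A -> bool) (l : list A) :
  lsum f l = lsum f (filter t l) + lsum f (filter (fun x => negb (t x)) l).
Proof. induction l as [|a l IH]; simpl; [lra|]. destruct (t a); simpl; lra. Qed.

(** Every entry reappears in the fibre over its value. Only an inequality holds, since [ks] may
    repeat a value. *)
Lemma lsum_fibers {A B : Type} (F : A -> R) (h : A -> B) (l : list A) (ks : list B) :
  (forall x, In x l -> 0 <= F x) -> (forall x, In x l -> In (h x) ks) ->
  lsum F l <= lsum (fun k => lsum F (filter (fun x => classical_eqb (h x) k) l)) ks.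
Proof.
  induction l as [|a l IH]; intros HF Hk.
  - simpl. apply lsum_nonneg. intros; simpl; lra.
  - assert (H1 : lsum F l <= lsum (fun k => lsum F (filter (fun x => classical_eqb (h x) k) l)) ks).
    { apply IH; intros; [apply HF | apply Hk]; now right. }
    assert (H2 : F a <= lsum (fun k => if classical_eqb (h a) k then F a else 0) ks).
    { replace (F a) with (lsum (fun k => if classical_eqb (h a) k then F a else 0) [h a]) at 1.
      - apply lsum_incl.
        + constructor; [easy|constructor].
        + intros x [<-|[]]. apply Hk. now left.
        + intros x _. assert (0 <= F a) by (apply HF; now left). destruct classical_eqb; lra.
      - simpl. rewrite (proj2 (classical_eqb_true (h a) (h a))); [lra|reflexivity]. }
    simpl lsum at 1.
    rewrite (lsum_ext _ (fun k => (if classical_eqb (h a) k then F a else 0)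
              + lsum F (filter (fun x => classical_eqb (h x) k) l))).
    + rewrite lsum_plus. lra.
    + intros k _. simpl. destruct classical_eqb; simpl; lra.
Qed.

(** Testing duplicate-free lists bounds a cardinality without a separate proof of finiteness. The
    bound is real so that estimates such as [C * M^eps] can be used directly. *)
Definition card_le {A : Type} (P : A -> Prop) (c : R) : Prop :=
  forall l, NoDup l -> (forall x, In x l -> P x) -> INR (length l) <= c.

Lemma card_le_weaken {A : Type} (P Q : A -> Prop) (c c' : R) :
  card_le P c -> (forall x, Q x -> P x) -> c <= c' -> card_le Q c'.
Proof. intros H HQ Hc l Hl HP. apply Rle_trans with c; auto. Qed.

(** This supplies a base point: a count may be carried out relative to one fixed element of the
    set. *)
Lemma card_le_nonempty {A : Type} (P : A -> Prop) (c : R) :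
  0 <= c -> (forall x, P x -> card_le P c) -> card_le P c.
Proof.
  intros Hc H l Hl HP. destruct l as [|a l]; [simpl; lra|].
  apply (H a); auto. apply HP. now left.
Qed.

Lemma card_le_fibers {A B : Type} (P : A -> Prop) (Q : B -> Prop) (h : A -> B) (c1 c2 : R) :
  0 <= c2 -> (forall x, P x -> Q (h x)) -> card_le Q c1 ->
  (forall y, Q y -> card_le (fun x => P x /\ h x = y) c2) -> card_le P (c1 * c2).
Proof.
  intros Hc2 HPQ HQ Hf l Hl HP.
  set (ks := nodup eq_dec_classic (map h l)).
  assert (Hks : forall k, In k ks -> Q k).
  { intros k Hk. apply nodup_In, in_map_iff in Hk. destruct Hk as (x & <- & Hx). auto. }
  replace (INR (length l)) with (lsum (fun _ : A => 1) l) by (rewrite lsum_const; lra).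
  eapply Rle_trans; [apply (lsum_fibers _ h l ks)|].
  - intros; lra.
  - intros x Hx. apply nodup_In. now apply in_map.
  - apply Rle_trans with (lsum (fun _ : B => c2) ks).
    + apply lsum_le. intros k Hk. rewrite lsum_const, Rmult_1_r.
      apply (Hf k (Hks k Hk)).
      * now apply NoDup_filter.
      * intros x Hx. apply filter_In in Hx. destruct Hx as [Hx Hx']. split; auto.
        now apply classical_eqb_true.
    + rewrite lsum_const. apply Rmult_le_compat_r; [easy|]. apply HQ; [apply NoDup_nodup|easy].
Qed.

Lemma card_le_singleton {A : Type} (P : A -> Prop) (c : R) :
  1 <= c -> (forall x y, P x -> P y -> x = y) -> card_le P c.
Proof.
  intros Hc H [|a [|b l]] Hl HP.
  - simpl; lra.
  - simpl; lra.
  - exfalso. inversion Hl as [|? ? Ha ?]; subst. apply Ha. left. apply H; apply HP; simpl; auto.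
Qed.

Lemma card_le_inj {A B : Type} (P : A -> Prop) (Q : B -> Prop) (h : A -> B) (c : R) :
  (forall x, P x -> Q (h x)) -> (forall x y, P x -> P y -> h x = h y -> x = y) ->
  card_le Q c -> card_le P c.
Proof.
  intros HPQ Hh HQ. rewrite <- (Rmult_1_r c). apply (card_le_fibers P Q h); auto; [lra|].
  intros y _. apply card_le_singleton; [lra|]. intros x x' [Hx Hy] [Hx' Hy']. apply Hh; congruence.
Qed.

(** Choosing a preimage of each point gives an injection into [Q]; the base point is there to show
    that [B] is inhabited, as [epsilon] requires. *)
Lemma card_le_image {A B : Type} (P : A -> Prop) (Q : B -> Prop) (g : B -> A) (c : R) :
  (forall x, P x -> exists y, Q y /\ g y = x) -> card_le Q c -> card_le P c.
Proof.
  intros H HQ. apply card_le_nonempty.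
  { apply (HQ []); [constructor|easy]. }
  intros x0 Hx0. destruct (H x0 Hx0) as (y0 & _).
  assert (inhabited B) as HB by (constructor; exact y0).
  apply (card_le_inj P Q (fun x => epsilon HB (fun y => Q y /\ g y = x))); auto.
  - intros x Hx. apply (epsilon_spec HB (fun y => Q y /\ g y = x)). auto.
  - intros x y Hx Hy Hxy.
    destruct (epsilon_spec HB (fun z => Q z /\ g z = x) (H x Hx)) as [_ E1].
    destruct (epsilon_spec HB (fun z => Q z /\ g z = y) (H y Hy)) as [_ E2].
    rewrite <- E1, <- E2, Hxy. reflexivity.
Qed.

Lemma card_le_prod {A B : Type} (P : A -> Prop) (Q : B -> Prop) (c1 c2 : R) :
  card_le P c1 -> card_le Q c2 -> card_le (fun x => P (fst x) /\ Q (snd x)) (c1 * c2).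
Proof.
  intros HP HQ. apply (card_le_fibers _ P fst); try tauto.
  - apply (HQ []); [constructor|easy].
  - intros y Hy. apply (card_le_inj _ Q snd); try tauto.
    intros [a b] [a' b'] [_ H] [_ H'] E; simpl in *; congruence.
Qed.

Lemma card_le_interval (lo hi : Z) :
  (lo <= hi + 1)%Z -> card_le (fun z => (lo <= z <= hi)%Z) (IZR (hi - lo + 1)).
Proof.
  intros H l Hl HP.
  rewrite <- (Z2Nat.id (hi - lo + 1)) by lia. rewrite <- INR_IZR_INZ. apply le_INR.
  rewrite <- (length_seq (Z.to_nat (hi - lo + 1)) 0).
  rewrite <- (length_map (fun i => lo + Z.of_nat i)%Z).
  apply NoDup_incl_length; auto.
  intros x Hx. apply HP in Hx. apply in_map_iff. exists (Z.to_nat (x - lo)).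
  rewrite in_seq. lia.
Qed.

Lemma card_le_bool : card_le (fun _ : bool => True) 2.
Proof.
  intros l Hl _. apply (le_INR _ 2).
  apply (NoDup_incl_length (l' := [true; false])); auto.
  intros [] _; simpl; auto.
Qed.

(** * The divisor bound *)

Definition divs (n d : Z) : Prop := (0 < d)%Z /\ (d | n)%Z.

(** For [n >= 1] this says that all prime factors of [n] are at least [B]. Speaking of all divisors
    makes it vacuous at [B = 2] and lets it pass to divisors at once. *)
Definition rough (B n : Z) : Prop := forall d, (d | n)%Z -> (1 < d)%Z -> (B <= d)%Z.

Lemma prime_divisor_exists (n : Z) : (1 < n)%Z -> exists p, prime p /\ (p | n)%Z.
Proof.
  intros Hn. revert Hn. assert (H0 : (0 <= n)%Z \/ (n < 0)%Z) by lia.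
  destruct H0 as [H0|]; [|lia].
  pattern n. apply Z_lt_induction; [|easy]. clear n H0. intros n IH Hn.
  destruct (prime_dec n) as [Hp|Hp].
  - exists n. split; [easy|apply Z.divide_refl].
  - destruct (not_prime_divide n Hn Hp) as (d & Hd & Hdn).
    destruct (IH d) as (p & Hp' & Hpd); [lia|lia|].
    exists p. split; [easy|]. now apply Z.divide_trans with d.
Qed.

(** Factors [p] are stripped from [d] one at a time; once [p] does not divide [d], Gauss's lemma
    discards the remaining powers. If [p | n] the decomposition is not unique, which is harmless for
    an upper bound. *)
Lemma divisor_of_prime_power_mult (p n : Z) (e : nat) (d : Z) :
  prime p -> (0 < d)%Z -> (d | p ^ Z.of_nat e * n)%Z ->
  exists i d', (0 <= i <= Z.of_nat e)%Z /\ divs n d' /\ d = (p ^ i * d')%Z.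
Proof.
  intros Hp. revert d. induction e as [|e IH]; intros d Hd0 Hd.
  - exists 0%Z, d. simpl Z.of_nat in *. rewrite Z.pow_0_r, Z.mul_1_l in *.
    repeat split; auto; lia.
  - assert (Hp1 := prime_ge_2 p Hp).
    rewrite Nat2Z.inj_succ, Z.pow_succ_r, <- Z.mul_assoc in Hd by lia.
    destruct (Zdivide_dec p d) as [[d1 ->]|Hpd].
    + destruct (IH d1) as (i & d' & Hi & Hd' & ->).
      * nia.
      * rewrite (Z.mul_comm d1) in Hd. apply Z.mul_divide_cancel_l in Hd; [easy|lia].
      * exists (Z.succ i), d'. rewrite Z.pow_succ_r by lia. split; [lia|]. split; [easy|ring].
    + destruct (IH d Hd0) as (i & d' & Hi & Hd').
      * apply Z.gauss with p; [easy|]. rewrite Z.gcd_comm. apply Zgcd_1_rel_prime.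
        now apply prime_rel_prime.
      * exists i, d'. split; [lia|easy].
Qed.

Lemma card_divs_prime_power_mult (p n : Z) (e : nat) (c : R) :
  prime p -> card_le (divs n) c ->
  card_le (divs (p ^ Z.of_nat e * n)%Z) ((INR e + 1) * c).
Proof.
  intros Hp Hc.
  apply (card_le_image _ (fun x => (0 <= fst x <= Z.of_nat e)%Z /\ divs n (snd x))
           (fun x => (p ^ fst x * snd x)%Z)).
  - intros d [Hd0 Hd].
    destruct (divisor_of_prime_power_mult p n e d Hp Hd0 Hd) as (i & d' & Hi & Hd' & ->).
    exists (i, d'). auto.
  - replace (INR e + 1) with (IZR (Z.of_nat e - 0 + 1)).
    + apply (card_le_prod (fun i => (0 <= i <= Z.of_nat e)%Z)); [|easy].
      apply card_le_interval. lia.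
    + rewrite plus_IZR, Z.sub_0_r, <- INR_IZR_INZ. reflexivity.
Qed.

Lemma Rpower_ge_1 (x y : R) : 1 <= x -> 0 <= y -> 1 <= Rpower x y.
Proof.
  intros Hx Hy. rewrite <- (Rpower_O x) by lra. now apply Rle_Rpower.
Qed.

Lemma Rpower_IZR_mult (a b : Z) (e : R) :
  (0 < a)%Z -> (0 < b)%Z -> Rpower (IZR (a * b)) e = Rpower (IZR a) e * Rpower (IZR b) e.
Proof.
  intros Ha Hb. rewrite mult_IZR. symmetry. apply Rpower_mult_distr; now apply IZR_lt.
Qed.

(** Each prime factor [p >= B] at most doubles the number of divisors, and pays for it with
    [p^delta >= 2]. *)
Lemma card_divs_very_rough (B : Z) (delta : R) :
  0 < delta -> (2 <= B)%Z -> 2 <= Rpower (IZR B) delta ->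
  forall n, (1 <= n)%Z -> rough B n -> card_le (divs n) (Rpower (IZR n) delta).
Proof.
  intros Hdelta HB H2 n Hn.
  assert (H0 : (0 <= n)%Z) by lia. revert Hn.
  pattern n. apply Z_lt_induction; [|easy]. clear n H0. intros n IH Hn Hr.
  destruct (Z.eq_dec n 1) as [->|Hn1].
  - apply card_le_singleton; [apply Rpower_ge_1; lra|].
    intros x y [Hx Hx'] [Hy Hy']. apply Z.divide_1_r_nonneg in Hx', Hy'; lia.
  - destruct (prime_divisor_exists n) as (p & Hp & [n' ->]); [lia|].
    assert (Hp1 := prime_ge_2 p Hp).
    assert (HBp : (B <= p)%Z) by (apply Hr; [exists n'; ring|lia]).
    assert (Hn' : (1 <= n')%Z) by nia.
    replace (n' * p)%Z with (p ^ Z.of_nat 1 * n')%Z by (simpl Z.of_nat; rewrite Z.pow_1_r; ring).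
    eapply card_le_weaken;
      [apply (card_divs_prime_power_mult p n' 1 (Rpower (IZR n') delta) Hp)| |].
    + apply IH; [nia|easy|]. intros d Hd Hd1. apply Hr; [|easy]. now apply Z.divide_mul_l.
    + auto.
    + simpl Z.of_nat. rewrite Z.pow_1_r, Rpower_IZR_mult by lia.
      apply Rmult_le_compat_r; [left; apply exp_pos|].
      simpl INR. replace (1 + 1) with 2 by ring. apply Rle_trans with (1 := H2).
      apply Rle_Rpower_l; [lra|]. split; [apply IZR_lt; lia|now apply IZR_le].
Qed.

Lemma split_off_powers (B n : Z) : (2 <= B)%Z -> (1 <= n)%Z ->
  exists (e : nat) m, (1 <= m)%Z /\ n = (B ^ Z.of_nat e * m)%Z /\ ~ (B | m)%Z.
Proof.
  intros HB Hn. assert (H0 : (0 <= n)%Z) by lia. revert Hn.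
  pattern n. apply Z_lt_induction; [|easy]. clear n H0. intros n IH Hn.
  destruct (Zdivide_dec B n) as [[n' ->]|HBn].
  - destruct (IH n') as (e & m & Hm & -> & HBm); [nia|nia|].
    exists (S e), m. rewrite Nat2Z.inj_succ, Z.pow_succ_r by lia. repeat split; auto; ring.
  - exists 0%nat, n. simpl Z.of_nat. rewrite Z.pow_0_r. repeat split; auto; ring.
Qed.

(** From [b^(e delta) >= 2^(e delta) >= 1 + e delta ln 2]; comparing with the base 2 makes the
    constant independent of [b]. *)
Lemma succ_le_exponential (delta : R) : 0 < delta ->
  exists C, 0 < C /\ forall (b : Z) (e : nat), (2 <= b)%Z ->
    INR e + 1 <= C * Rpower (IZR (b ^ Z.of_nat e)) delta.
Proof.
  intros Hd. assert (Hl : 0 < ln 2) by (rewrite <- ln_1; apply ln_increasing; lra).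
  assert (Hdl : 0 < delta * ln 2) by (now apply Rmult_lt_0_compat).
  exists (1 + / (delta * ln 2)).
  assert (Hi := Rinv_0_lt_compat _ Hdl). split; [lra|]. intros b e Hb.
  assert (H1 : 1 + INR e * (delta * ln 2) <= Rpower (IZR (b ^ Z.of_nat e)) delta).
  { apply Rle_trans with (Rpower (IZR (2 ^ Z.of_nat e)) delta).
    - unfold Rpower. rewrite <- pow_IZR, ln_pow by lra.
      replace (delta * (INR e * ln 2)) with (INR e * (delta * ln 2)) by ring.
      apply exp_ineq1_le.
    - apply Rle_Rpower_l; [lra|]. split; [apply IZR_lt; apply Z.pow_pos_nonneg; lia|].
      apply IZR_le. apply Z.pow_le_mono_l. lia. }
  apply Rle_trans with ((1 + / (delta * ln 2)) * (1 + INR e * (delta * ln 2))).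
  - assert (He := pos_INR e).
    replace ((1 + / (delta * ln 2)) * (1 + INR e * (delta * ln 2))) with
      (1 + INR e + / (delta * ln 2) + INR e * (delta * ln 2)) by (field; lra).
    nra.
  - apply Rmult_le_compat_l; lra.
Qed.

(* Downward induction on the roughness [B]: removing the prime [B] costs a factor
   [(e + 1) / B^(e delta)], which is bounded. *)
Lemma divisor_bound (delta : R) : 0 < delta ->
  exists C, 0 < C /\ forall n, (1 <= n)%Z -> card_le (divs n) (C * Rpower (IZR n) delta).
Proof.
  intros Hd.
  assert (Hdesc : forall k B, (2 <= B)%Z -> 2 <= Rpower (IZR (B + Z.of_nat k)) delta ->
    exists C, 0 < C /\ forall n, (1 <= n)%Z -> rough B n ->
      card_le (divs n) (C * Rpower (IZR n) delta)).
  { induction k as [|k IH]; intros B HB H2.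
    - rewrite Z.add_0_r in H2. exists 1. split; [lra|]. intros n Hn Hr. rewrite Rmult_1_l.
      now apply card_divs_very_rough with B.
    - destruct (IH (B + 1)%Z) as (C & HC & Hb); [lia| |].
      { replace (B + 1 + Z.of_nat k)%Z with (B + Z.of_nat (S k))%Z by lia. easy. }
      destruct (succ_le_exponential delta Hd) as (C' & HC' & Hb').
      assert (Hrough : forall m, rough B m -> ~ (B | m)%Z -> rough (B + 1) m).
      { intros m Hm HBm d Hdm Hd1. specialize (Hm d Hdm Hd1).
        assert (d <> B) by congruence. lia. }
      exists (C' * C). split; [now apply Rmult_lt_0_compat|]. intros n Hn Hr.
      destruct (split_off_powers B n HB Hn) as (e & m & Hm & -> & HBm).
      assert (Hrm : rough (B + 1) m).
      { apply Hrough; auto. intros d Hdm. apply Hr. now apply Z.divide_mul_r. }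
      destruct e as [|e].
      + simpl Z.of_nat. rewrite Z.pow_0_r, Z.mul_1_l.
        apply card_le_weaken with (1 := Hb m Hm Hrm); auto.
        apply Rmult_le_compat_r; [left; apply exp_pos|].
        rewrite <- (Rmult_1_l C) at 1. apply Rmult_le_compat_r; [lra|].
        (* At [e = 0] the exponential bound reads [1 <= C']. *)
        specialize (Hb' 2%Z 0%nat ltac:(lia)). simpl Z.of_nat in Hb'.
        rewrite Z.pow_0_r in Hb'. unfold Rpower in Hb'.
        rewrite ln_1, Rmult_0_r, exp_0 in Hb'. simpl in Hb'. lra.
      (* Here [B] divides a [B]-rough number, so a divisor of [B] strictly between 1 and [B] would
         contradict roughness. *)
      + assert (HpB : prime B).
        { destruct (prime_dec B) as [HpB|HpB]; [easy|].
          destruct (not_prime_divide B ltac:(lia) HpB) as (d & Hd1 & Hdn).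
          assert (B <= d)%Z; [|lia]. apply Hr; [|lia].
          rewrite Nat2Z.inj_succ, Z.pow_succ_r, <- Z.mul_assoc by lia.
          now apply Z.divide_mul_l. }
        eapply card_le_weaken.
        * exact (card_divs_prime_power_mult B m (S e) _ HpB (Hb m Hm Hrm)).
        * auto.
        * rewrite Rpower_IZR_mult; [|apply Z.pow_pos_nonneg; lia|lia].
          replace (C' * C * (Rpower (IZR (B ^ Z.of_nat (S e))) delta * Rpower (IZR m) delta))
            with ((C' * Rpower (IZR (B ^ Z.of_nat (S e))) delta) * (C * Rpower (IZR m) delta))
            by ring.
          apply Rmult_le_compat_r; [|now apply Hb'].
          apply Rmult_le_pos; [lra|left; apply exp_pos]. }
  (* The descent starts at [2 + k >= 2^(1/delta)], where every prime factor pays for itself, and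
     ends at roughness 2. *)
  set (k := Z.to_nat (up (Rpower 2 (/ delta)))).
  destruct (Hdesc k 2%Z) as (C & HC & Hb); [lia| |].
  - apply Rle_trans with (Rpower (Rpower 2 (/ delta)) delta).
    + rewrite Rpower_mult, Rinv_l, Rpower_1 by lra. lra.
    + apply Rle_Rpower_l; [lra|]. split; [apply exp_pos|].
      destruct (archimed (Rpower 2 (/ delta))) as [Hup _].
      rewrite plus_IZR. apply Rle_trans with (IZR (Z.of_nat k)); [|lra].
      unfold k. apply Rle_trans with (IZR (up (Rpower 2 (/ delta)))); [lra|]. apply IZR_le. lia.
  - exists C. split; [easy|]. intros n Hn. apply Hb; [easy|]. intros d _ H1. lia.
Qed.

(** * Solutions of x^2 - D m^2 = K *)

Lemma gcd_square_dvd (a b : Z) : (a * a | b * b)%Z -> (a | b)%Z.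
Proof.
  intros H. destruct (Z.eq_dec (Z.gcd a b) 0) as [E|Hg].
  { apply Z.gcd_eq_0 in E. destruct E as [-> ->]. apply Z.divide_refl. }
  destruct (Z.gcd_divide_l a b) as [a' Ha], (Z.gcd_divide_r a b) as [b' Hb].
  set (g := Z.gcd a b) in *.
  assert (Hg0 : (0 <= g)%Z) by apply Z.gcd_nonneg.
  assert (Hc : Z.gcd a' b' = 1%Z).
  { assert (E : (Z.gcd (a' * g) (b' * g) = Z.gcd a' b' * g)%Z)
      by (now apply Z.gcd_mul_mono_r_nonneg).
    rewrite <- Ha, <- Hb in E. fold g in E. nia. }
  assert (Hd : (a' | b' * b')%Z).
  { destruct H as [k Hk]. exists (k * a')%Z. rewrite Ha, Hb in Hk.
    apply Z.mul_reg_r with (g * g)%Z; [nia|]. nia. }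
  apply Z.gauss in Hd; [|easy]. destruct Hd as [k ->].
  exists k. rewrite Hb, Ha. ring.
Qed.

(** If [x^2 = D m^2] then [m^2 | x^2], hence [m | x], and [D] is the square of the quotient. *)
Lemma norm_nonzero (D x m : Z) :
  ~ (exists k, (k * k)%Z = D) -> m <> 0%Z -> (x * x - D * (m * m) <> 0)%Z.
Proof.
  intros HD Hm H. apply HD.
  destruct (gcd_square_dvd m x) as [k ->]; [exists D; lia|].
  exists k. apply Z.mul_reg_r with (m * m)%Z; nia.
Qed.

Definition prim_sol (D K : Z) (s : Z * Z) : Prop :=
  (0 <= fst s)%Z /\ (0 < snd s)%Z /\ Z.gcd (fst s) (snd s) = 1%Z /\
  (fst s * fst s - D * (snd s * snd s))%Z = K.

Lemma coprime_dvd_square_mul (h m a : Z) :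
  Z.gcd h m = 1%Z -> (h * h | a * (m * m))%Z -> (h * h | a)%Z.
Proof.
  intros Hg H. apply Z.gauss with (m * m)%Z; [now rewrite (Z.mul_comm _ a)|].
  apply Zgcd_1_rel_prime.
  assert (Hr : rel_prime h m) by (now apply Zgcd_1_rel_prime).
  apply rel_prime_sym, rel_prime_mult; apply rel_prime_sym; now apply rel_prime_mult.
Qed.

Lemma gcd_norm_1 (D x m : Z) :
  Z.gcd x m = 1%Z -> Z.gcd (x * x - D * (m * m)) m = 1%Z.
Proof.
  intros H. apply Zgcd_1_rel_prime in H.
  assert (Hxx : rel_prime m (x * x)) by (apply rel_prime_mult; now apply rel_prime_sym).
  apply Zgcd_1_rel_prime in Hxx. rewrite Z.gcd_comm, <- Hxx.
  replace (x * x - D * (m * m))%Z with (x * x + (- (D * m)) * m)%Z by ring.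
  apply Z.gcd_add_mult_diag_r.
Qed.

(* With [g = gcd (x m0 - x0 m, K)], the identity
   [(x m0 - x0 m) (x m0 + x0 m) = K (m0^2 - m^2)] gives [K / g | x m0 + x0 m]. Two solutions with
   the same [g] are therefore proportional modulo [K / h], [h = gcd (g, K / g)], and [h^2 | 4 D]. *)
Lemma same_class_cross (D K : Z) (s0 s s' : Z * Z) :
  K <> 0%Z -> D <> 0%Z -> prim_sol D K s0 -> prim_sol D K s -> prim_sol D K s' ->
  Z.gcd (fst s * snd s0 - fst s0 * snd s) K = Z.gcd (fst s' * snd s0 - fst s0 * snd s') K ->
  (K | 4 * D * (fst s * snd s' - fst s' * snd s))%Z.
Proof.
  destruct s0 as [x0 m0], s as [x m], s' as [x' m']. unfold prim_sol; simpl.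
  intros HK HD (_ & _ & Hg0 & E0) (_ & _ & Hg & E) (_ & _ & Hg' & E') Eg.
  set (g := Z.gcd (x * m0 - x0 * m) K) in *.
  assert (HgK : (g | K)%Z) by apply Z.gcd_divide_r.
  assert (Hgp : g <> 0%Z) by (intros H; unfold g in H; apply Z.gcd_eq_0 in H; tauto).
  assert (Hgl : (g | x * m0 - x0 * m)%Z) by apply Z.gcd_divide_l.
  assert (Hgl' : (g | x' * m0 - x0 * m')%Z) by (rewrite Eg; apply Z.gcd_divide_l).
  destruct HgK as [k2 Hk2].
  assert (Hplus : forall u v, (u * u - D * (v * v))%Z = K ->
            Z.gcd (u * m0 - x0 * v) K = g -> (k2 | u * m0 + x0 * v)%Z).
  { intros u v Euv Eguv.
    destruct (Z.gcd_divide_l (u * m0 - x0 * v) K) as [a Ha]. rewrite Eguv in Ha.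
    apply Z.gauss with a.
    - exists (m0 * m0 - v * v)%Z. apply Z.mul_reg_r with g; [easy|].
      replace (a * (u * m0 + x0 * v) * g)%Z with ((u * m0 - x0 * v) * (u * m0 + x0 * v))%Z
        by (rewrite Ha; ring).
      replace ((m0 * m0 - v * v) * k2 * g)%Z with ((m0 * m0 - v * v) * K)%Z by (rewrite Hk2; ring).
      nia.
    - assert (Eg2 : (Z.gcd (a * g) (k2 * g) = Z.gcd a k2 * Z.abs g)%Z)
        by apply Z.gcd_mul_mono_r.
      rewrite <- Ha, <- Hk2, Eguv in Eg2.
      assert (Hg0' : (0 <= g)%Z) by apply Z.gcd_nonneg.
      rewrite Z.gcd_comm. nia. }
  assert (HB := Hplus x m E eq_refl). assert (HB' := Hplus x' m' E' (eq_sym Eg)).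
  assert (Hm0 : Z.gcd K m0 = 1%Z) by (rewrite <- E0; now apply gcd_norm_1).
  assert (HmK : Z.gcd K m = 1%Z) by (rewrite <- E; now apply gcd_norm_1).
  set (W := (x * m' - x' * m)%Z).
  assert (Hcop : forall d c, (d | K)%Z -> Z.gcd K c = 1%Z -> Z.gcd d c = 1%Z).
  { intros d c Hd Hc. apply Z.divide_antisym_nonneg; [apply Z.gcd_nonneg|lia| |apply Z.divide_1_l].
    rewrite <- Hc. apply Z.gcd_greatest; [|apply Z.gcd_divide_r].
    apply Z.divide_trans with (2 := Hd). apply Z.gcd_divide_l. }
  assert (HgK : (g | K)%Z) by (exists k2; lia).
  assert (Hk2K : (k2 | K)%Z) by (exists g; lia).
  assert (HgW : (g | W)%Z).
  { apply Z.gauss with m0; [|now apply Hcop].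
    replace (m0 * W)%Z with ((x * m0 - x0 * m) * m' - (x' * m0 - x0 * m') * m)%Z
      by (unfold W; ring).
    apply Z.divide_sub_r; now apply Z.divide_mul_l. }
  assert (HkW : (k2 | W)%Z).
  { apply Z.gauss with m0; [|now apply Hcop].
    replace (m0 * W)%Z with ((x * m0 + x0 * m) * m' - (x' * m0 + x0 * m') * m)%Z
      by (unfold W; ring).
    apply Z.divide_sub_r; now apply Z.divide_mul_l. }
  (* By Bezout [h] is a combination of [g] and [k2]. Both divide [W] and their product is [K], so
     [K | h W]. *)
  set (h := Z.gcd g k2).
  assert (HhW : (K | h * W)%Z).
  { destruct (Z.gcd_bezout g k2 h eq_refl) as (u & v & Huv). rewrite <- Huv.
    destruct HgW as [w1 Hw1], HkW as [w2 Hw2].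
    exists (u * w2 + v * w1)%Z. rewrite Hk2.
    replace ((u * g + v * k2) * W)%Z with (u * g * W + v * k2 * W)%Z by ring.
    rewrite Hw2 at 1. rewrite Hw1. ring. }
  assert (Hhg : (h | g)%Z) by apply Z.gcd_divide_l.
  assert (Hhk : (h | k2)%Z) by apply Z.gcd_divide_r.
  assert (HhK : (h | K)%Z) by (now apply Z.divide_trans with g).
  assert (Hh2K : (h * h | K)%Z) 
    by (destruct Hhg as [c1 E1], Hhk as [c2 E2]; exists (c2 * c1)%Z; rewrite Hk2, E1, E2; ring).
  (* [h] divides both [x m0 - x0 m] and [x m0 + x0 m], hence [2 x m0], and [m0] is coprime to [K].
     Then [h^2] divides [(2 x)^2 - 4 K = 4 D m^2], with [m] coprime to [h]. *)
  assert (Hh2x : (h | 2 * x)%Z).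
  { apply Z.gauss with m0; [|now apply Hcop].
    replace (m0 * (2 * x))%Z with ((x * m0 - x0 * m) + (x * m0 + x0 * m))%Z by ring.
    apply Z.divide_add_r; [now apply Z.divide_trans with g|now apply Z.divide_trans with k2]. }
  assert (Hh4D : (h * h | 4 * D)%Z).
  { apply coprime_dvd_square_mul with m; [now apply Hcop|].
    replace (4 * D * (m * m))%Z with ((2 * x) * (2 * x) - 4 * K)%Z by (rewrite <- E; ring).
    apply Z.divide_sub_r; [|now apply Z.divide_mul_r].
    destruct Hh2x as [c ->]. exists (c * c)%Z. ring. }
  apply Z.divide_trans with (1 := HhW). fold W. apply Z.mul_divide_mono_r.
  destruct Hh4D as [c Hc]. exists (c * h)%Z. now rewrite <- Z.mul_assoc.
Qed.

(** With [T = x m' + x' m] one has [W T = K (m'^2 - m^2)], and [|m'^2 - m^2| <= 2 m m'] because [m]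
    and [m'] are within a factor two. If [T >= m m'], divide. Otherwise [x < m] and [x' < m'], so
    [|W| < m m'], while [-K = D m^2 - x^2 >= m^2] and likewise for [m'], so that [m m' <= |K|]. *)
Lemma cross_bound (D K x m x' m' : Z) :
  (2 <= D)%Z -> (0 <= x)%Z -> (0 < m)%Z -> (0 <= x')%Z -> (0 < m')%Z ->
  (x * x - D * (m * m))%Z = K -> (x' * x' - D * (m' * m'))%Z = K ->
  (m < 2 * m')%Z -> (m' < 2 * m)%Z -> K <> 0%Z ->
  (Z.abs (x * m' - x' * m) <= 2 * Z.abs K)%Z.
Proof.
  intros HD Hx Hm Hx' Hm' E E' H1 H2 HK.
  set (W := (x * m' - x' * m)%Z). set (T := (x * m' + x' * m)%Z).
  assert (HWT : (W * T = K * (m' * m' - m * m))%Z) by (unfold W, T; nia).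
  assert (Hmm : (0 < m * m')%Z) by nia.
  assert (HT0 : (0 <= T)%Z) by (unfold T; nia).
  assert (Hd : (Z.abs (m' * m' - m * m) <= 2 * (m * m'))%Z) by nia.
  destruct (Z.le_gt_cases (m * m') T) as [HT|HT].
  - assert (Ha : (Z.abs W * T = Z.abs K * Z.abs (m' * m' - m * m))%Z).
    { rewrite <- Z.abs_mul, <- HWT, Z.abs_mul, (Z.abs_eq T); lia. }
    assert (H3 : (Z.abs W * (m * m') <= Z.abs K * (2 * (m * m')))%Z).
    { apply Z.le_trans with (Z.abs W * T)%Z.
      - apply Z.mul_le_mono_nonneg_l; lia.
      - rewrite Ha. apply Z.mul_le_mono_nonneg_l; lia. }
    apply Z.mul_le_mono_pos_r with (m * m')%Z; lia.
  - assert (Hxm : (x < m)%Z) by (unfold T in HT; nia).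
    assert (Hxm' : (x' < m')%Z) by (unfold T in HT; nia).
    assert (HW : (Z.abs W < m * m')%Z) by (unfold W; unfold T in HT; nia).
    assert (HL : (m * m <= - K)%Z) by nia.
    assert (HL' : (m' * m' <= - K)%Z) by nia.
    assert (m * m' <= - K)%Z by nia. lia.
Qed.

(** The factor [c] counts the classes. Within the class of a fixed [s'], the integer [4 D W / K]
    lies between [-8 D] and [8 D], which leaves [16 D + 1] values of [W]; the last factor 2 is the
    sign of [U], since [U^2 = K^2 + D W^2]. *)
Lemma card_prim_sol (D K : Z) (P : Z * Z -> Prop) (c : R) :
  (2 <= D)%Z -> K <> 0%Z -> (forall s, P s -> prim_sol D K s) ->
  (forall s s', P s -> P s' -> (snd s < 2 * snd s')%Z) ->
  card_le (divs (Z.abs K)) c -> card_le P (c * IZR (2 * (16 * D + 1))).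
Proof.
  intros HD HK HP Hm Hc.
  assert (Hc0 : 0 <= c) by (apply (Hc []); [constructor|easy]).
  apply card_le_nonempty; [apply Rmult_le_pos; [easy|apply IZR_le; lia]|].
  intros s0 Hs0.
  apply (card_le_fibers P (divs (Z.abs K))
    (fun s => Z.gcd (fst s * snd s0 - fst s0 * snd s) K)); auto; [apply IZR_le; lia| |].
  { intros s Hs. split.
    - assert (0 <= Z.gcd (fst s * snd s0 - fst s0 * snd s) K)%Z by apply Z.gcd_nonneg.
      assert (Z.gcd (fst s * snd s0 - fst s0 * snd s) K <> 0)%Z; [|lia].
      intros E. apply Z.gcd_eq_0 in E. tauto.
    - apply Z.divide_abs_r, Z.gcd_divide_r. }
  intros g _. apply card_le_nonempty; [apply IZR_le; lia|].
  intros s' [Hs' Hg'].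
  set (W := fun s : Z * Z => (fst s * snd s' - fst s' * snd s)%Z).
  set (U := fun s : Z * Z => (fst s * fst s' - D * (snd s * snd s'))%Z).
  assert (HW : forall s, P s /\ Z.gcd (fst s * snd s0 - fst s0 * snd s) K = g ->
                 (4 * D * W s)%Z = (4 * D * W s / K * K)%Z).
  { intros s [Hs Hg]. rewrite (Z.mul_comm (_ / K)).
    apply Z_div_exact_full_2; [easy|]. apply Zdivide_mod.
    apply (same_class_cross D K s0); auto; [lia|congruence]. }
  replace (IZR (2 * (16 * D + 1))) with (IZR (8 * D - - (8 * D) + 1) * 2)
    by (rewrite <- mult_IZR; f_equal; ring).
  apply (card_le_inj _ (fun v : Z * bool => (- (8 * D) <= fst v <= 8 * D)%Z /\ True)
     (fun s => ((4 * D * W s / K)%Z, Z.leb 0 (U s)))).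
  - intros s Hs. split; [|exact I]. change (- (8 * D) <= 4 * D * W s / K <= 8 * D)%Z.
    assert (Hb : (Z.abs (W s) <= 2 * Z.abs K)%Z).
    { assert (Hp := HP s (proj1 Hs)). assert (Hp' := HP s' Hs').
      destruct s as [x m], s' as [x' m'], Hp as (? & ? & ? & ?), Hp' as (? & ? & ? & ?).
      simpl in *.
      apply (cross_bound D); auto;
        [apply (Hm (x, m) (x', m'))|apply (Hm (x', m') (x, m))]; tauto. }
    specialize (HW s Hs). set (V := (4 * D * W s / K)%Z) in *.
    assert (HV : (Z.abs V * Z.abs K = 4 * D * Z.abs (W s))%Z).
    { rewrite <- Z.abs_mul, <- HW, Z.abs_mul, (Z.abs_eq (4 * D)); lia. }
    assert (Z.abs V * Z.abs K <= 8 * D * Z.abs K)%Z by (rewrite HV; nia).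
    assert (HVb : (Z.abs V <= 8 * D)%Z); [|clear - HVb; lia].
    apply Z.mul_le_mono_pos_r with (Z.abs K); [lia|assumption].
  - intros s t Hs Ht E.
    assert (EV : (4 * D * W s / K)%Z = (4 * D * W t / K)%Z) by exact (f_equal fst E).
    assert (EU : Z.leb 0 (U s) = Z.leb 0 (U t)) by exact (f_equal snd E). clear E.
    assert (Es := HW s Hs). assert (Et := HW t Ht). rewrite EV, <- Et in Es.
    assert (EW : W s = W t) by nia.
    destruct (HP s (proj1 Hs)) as (_ & _ & _ & Ks), (HP t (proj1 Ht)) as (_ & _ & _ & Kt),
      (HP s' Hs') as (_ & _ & _ & Ks').
    (* These are the norm of [r conj(s') = U - W sqrt D] and the two coordinates of
       [K r = (U - W sqrt D) s']. *)
    assert (HU : forall r, (fst r * fst r - D * (snd r * snd r))%Z = K ->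
       (U r * U r = K * K + D * (W r * W r))%Z /\
       (K * fst r = U r * fst s' - D * (W r * snd s'))%Z /\
       (K * snd r = U r * snd s' - W r * fst s')%Z).
    { intros [x m] Er. destruct s' as [x' m']. unfold U, W. simpl in *.
      split; [|split]; [|rewrite <- Ks'; ring|rewrite <- Ks'; ring].
      rewrite <- Er at 1. rewrite <- Ks'. ring. }
    destruct (HU s Ks) as (U1 & X1 & M1), (HU t Kt) as (U2 & X2 & M2).
    assert (EUU : U s = U t).
    { rewrite EW in U1. rewrite <- U2 in U1.
      destruct (Z.leb_spec 0 (U s)), (Z.leb_spec 0 (U t)); try discriminate; nia. }
    rewrite EUU, EW in *. destruct s as [x m], t as [x' m']. simpl in *.
    f_equal; apply Z.mul_reg_l with K; congruence.
  - apply (card_le_prod (fun z => (- (8 * D) <= z <= 8 * D)%Z) (fun _ : bool => True)).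
    + apply card_le_interval. lia.
    + apply card_le_bool.
Qed.

(** * From primitive solutions to all solutions in a dyadic block *)

Definition sol (D K : Z) (s : Z * Z) : Prop :=
  (fst s * fst s - D * (snd s * snd s))%Z = K.

Lemma gcd_reduce (x m g : Z) : Z.gcd x m = g -> (0 < g)%Z ->
  exists x' m', x = (x' * g)%Z /\ m = (m' * g)%Z /\ Z.gcd x' m' = 1%Z.
Proof.
  intros E Hg. destruct (Z.gcd_divide_l x m) as [x' Hx], (Z.gcd_divide_r x m) as [m' Hm].
  rewrite E in Hx, Hm. exists x', m'. repeat split; auto.
  rewrite Hx, Hm, Z.gcd_mul_mono_r_nonneg in E by lia. nia.
Qed.

(** Dividing by [g = gcd (x, m)] leaves a primitive solution for [K' = K / g^2], still confined to a
    factor-two range of [m]. The bound [c] is used twice: for the choices of [g | K], and for the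
    classes, as the divisors of [K'] divide [K]. *)
Lemma card_nonneg_sol (D K M : Z) (c : R) :
  (2 <= D)%Z -> K <> 0%Z -> (0 < M)%Z -> card_le (divs (Z.abs K)) c ->
  card_le (fun s => sol D K s /\ (0 <= fst s)%Z /\ (M <= snd s < 2 * M)%Z)
    (c * (c * IZR (2 * (16 * D + 1)))).
Proof.
  intros HD HK HM Hc.
  assert (Hc0 : 0 <= c) by (apply (Hc []); [constructor|easy]).
  assert (Hc1 : 0 <= c * IZR (2 * (16 * D + 1))) by (apply Rmult_le_pos; [easy|apply IZR_le; lia]).
  apply (card_le_fibers _ (divs (Z.abs K)) (fun s => Z.gcd (fst s) (snd s))); auto.
  - intros [x m] (E & Hx & Hm). unfold sol in E. simpl in *.
    assert (H0 : (0 <= Z.gcd x m)%Z) by apply Z.gcd_nonneg.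
    split.
    + assert (Z.gcd x m <> 0)%Z; [|lia]. intros H. apply Z.gcd_eq_0 in H. lia.
    + apply Z.divide_abs_r. rewrite <- E.
      apply Z.divide_sub_r; [apply Z.divide_mul_l, Z.gcd_divide_l|].
      apply Z.divide_mul_r, Z.divide_mul_r, Z.gcd_divide_r.
  - intros g [Hg HgK]. apply card_le_nonempty; [easy|].
    intros [x1 m1] [(E1 & _ & _) Eg1]. unfold sol in E1. simpl in *.
    destruct (gcd_reduce x1 m1 g Eg1 Hg) as (y1 & n1 & -> & -> & _).
    set (K' := (y1 * y1 - D * (n1 * n1))%Z).
    assert (EK : K = (K' * (g * g))%Z) by (rewrite <- E1; unfold K'; ring).
    apply (card_le_inj _ (fun s => prim_sol D K' s /\ (M <= snd s * g < 2 * M)%Z)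
      (fun s => (fst s / g, snd s / g)%Z)).
    + intros [x m] [(E & Hx & Hm) Eg]. unfold sol in E. simpl in *.
      destruct (gcd_reduce x m g Eg Hg) as (y & n & -> & -> & Hyn).
      rewrite !Z.div_mul by lia. unfold prim_sol. simpl.
      repeat split; auto; try nia.
    + intros [x m] [x' m'] [_ Eg] [_ Eg'] H. simpl in *.
      destruct (gcd_reduce x m g Eg Hg) as (y & n & -> & -> & _).
      destruct (gcd_reduce x' m' g Eg' Hg) as (y' & n' & -> & -> & _).
      rewrite !Z.div_mul in H by lia. congruence.
    + apply (card_prim_sol D K'); auto.
      * lia.
      * tauto.
      * intros s s' [_ H] [_ H']. nia.
      * apply card_le_weaken with (1 := Hc); [|lra].
        intros d [Hd Hdk]. split; [easy|]. apply Z.divide_abs_r.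
        apply (proj1 (Z.divide_abs_r _ _)) in Hdk.
        rewrite EK. now apply Z.divide_mul_l.
Qed.

(* When [K] is large compared to [D^2 M^4], [x = sqrt (K + D m^2)] varies by less than one
   over the block. *)
Lemma unique_sol_small_block (D K M : Z) (s t : Z * Z) :
  (2 <= D)%Z -> (0 < M)%Z -> (16 * D * D * (M * M * M * M) <= K)%Z ->
  sol D K s -> (0 <= fst s)%Z -> (M <= snd s < 2 * M)%Z ->
  sol D K t -> (0 <= fst t)%Z -> (M <= snd t < 2 * M)%Z -> s = t.
Proof.
  intros HD HM HK.
  assert (Hlt : forall x m x' m', (x * x - D * (m * m))%Z = K -> (x' * x' - D * (m' * m'))%Z = K ->
    (0 <= x)%Z -> (0 <= x')%Z -> (M <= m < 2 * M)%Z -> (M <= m' < 2 * M)%Z -> ~ (x' < x)%Z).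
  { intros x m x' m' E E' Hx Hx' Hm Hm' H.
    (* If [x' < x], then [x^2 - x'^2 >= 2 x' + 1 > 8 D M^2], whereas this difference equals
       [D (m^2 - m'^2) <= 4 D M^2]. *)
    assert (H1 : (4 * D * (M * M) <= x')%Z).
    { apply Z.square_le_simpl_nonneg; [easy|].
      replace (4 * D * (M * M) * (4 * D * (M * M)))%Z with (16 * D * D * (M * M * M * M))%Z by ring.
      nia. }
    assert (H2 : (m * m < 4 * (M * M))%Z) by nia.
    assert (H3 : ((x' + 1) * (x' + 1) <= x * x)%Z) by (apply Z.square_le_mono_nonneg; lia).
    assert (H4 : (0 <= D * (m' * m'))%Z) by (apply Z.mul_nonneg_nonneg; [lia|apply Z.square_nonneg]).
    assert (H5 : (D * (m * m) <= D * (4 * (M * M)))%Z) by (apply Z.mul_le_mono_nonneg_l; lia).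
    lia. }
  destruct s as [x m], t as [x' m']. unfold sol. simpl. intros E Hx Hm E' Hx' Hm'.
  assert (H1 := Hlt x m x' m' E E' Hx Hx' Hm Hm').
  assert (H2 := Hlt x' m' x m E' E Hx' Hx Hm' Hm).
  assert (x = x') by lia. subst x'. f_equal.
  assert (D * (m * m) = D * (m' * m'))%Z by lia.
  assert (m * m = m' * m')%Z by (apply Z.mul_reg_l with D; lia).
  nia.
Qed.

Lemma sol_block_count (D : Z) (eps : R) :
  (2 <= D)%Z -> ~ (exists k, (k * k)%Z = D) -> 0 < eps ->
  exists C, 0 < C /\ forall K M, (0 < M)%Z ->
    card_le (fun s => sol D K s /\ (M <= Z.abs (snd s) < 2 * M)%Z) (C * Rpower (IZR M) eps).
Proof.
  (* The divisor bound enters squared, and [|K|] is of size at most [M^4], so [|K|^delta]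
     contributes [M^(8 delta) = M^eps]. *)
  intros HD Hns Heps. set (delta := eps / 8). assert (Hdelta : 0 < delta) by (unfold delta; lra).
  destruct (divisor_bound delta Hdelta) as (C0 & HC0 & Hdiv).
  set (B := IZR (2 * (16 * D + 1))). assert (HB : 0 <= B) by (apply IZR_le; lia).
  set (a := Rpower (IZR (16 * D * D)) delta). assert (Ha : 0 < a) by apply exp_pos.
  set (C1 := C0 * a * (C0 * a * B)).
  assert (HC1 : 0 <= C1).
  { apply Rmult_le_pos; [|apply Rmult_le_pos; [|easy]]; apply Rmult_le_pos; lra. }
  (* The [+ 1] covers a block with a single solution; [2 * 2] restores the signs of [x] and [m]. *)
  exists ((C1 + 1) * (2 * 2)). split; [lra|]. intros K M HM.
  assert (Hm1 : 1 <= Rpower (IZR M) eps) by (apply Rpower_ge_1; [apply IZR_le; lia|lra]).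
  assert (Hpos : card_le (fun s => sol D K s /\ (0 <= fst s)%Z /\ (M <= snd s < 2 * M)%Z)
                    ((C1 + 1) * Rpower (IZR M) eps)).
  { assert (H1 : 1 <= (C1 + 1) * Rpower (IZR M) eps) by nra.
    apply card_le_nonempty; [lra|]. intros s (Es & Hx & Hm).
    destruct (Z.le_gt_cases (16 * D * D * (M * M * M * M)) K) as [HK|HK].
    - apply card_le_singleton; [easy|]. intros u v (? & ? & ?) (? & ? & ?).
      now apply (unique_sol_small_block D K M).
    - assert (HK0 : K <> 0%Z) by (rewrite <- Es; apply norm_nonzero; [easy|lia]).
      assert (HKa : (Z.abs K <= 16 * D * D * (M * M * M * M))%Z).
      (* This handles negative [K]: since [x^2 >= 0], [-K] is at most [D m^2]. *)
      { assert (- K <= 4 * D * (M * M))%Z by (unfold sol in Es;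
          assert (snd s * snd s <= 4 * (M * M))%Z by (clear - Hm; nia);
          assert (0 <= fst s * fst s)%Z by apply Z.square_nonneg;
          assert (D * (snd s * snd s) <= D * (4 * (M * M)))%Z
            by (apply Z.mul_le_mono_nonneg_l; lia); lia).
        assert (1 <= M * M)%Z by nia.
        assert (1 <= D * (M * M))%Z by nia.
        assert (4 * D * (M * M) <= 16 * D * D * (M * M * M * M))%Z; [|lia].
        replace (16 * D * D * (M * M * M * M))%Z
          with (16 * ((D * (M * M)) * (D * (M * M))))%Z by ring. nia. }
      set (m := Rpower (IZR M) delta). assert (Hm0 : 0 < m) by apply exp_pos.
      assert (HKR : Rpower (IZR (Z.abs K)) delta <= a * (m * m * m * m)).
      { unfold a, m. rewrite <- !Rpower_IZR_mult by nia.
        apply Rle_Rpower_l; [lra|]. split; [apply IZR_lt; lia|].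
        apply IZR_le. exact HKa. }
      set (c := C0 * (a * (m * m * m * m))).
      assert (Hc : card_le (divs (Z.abs K)) c).
      { apply card_le_weaken with (1 := Hdiv (Z.abs K) ltac:(lia)); [easy|].
        apply Rmult_le_compat_l; lra. }
      apply card_le_weaken with (1 := card_nonneg_sol D K M c HD HK0 HM Hc); [easy|].
      assert (Em : Rpower (IZR M) eps = (m * m * m * m) * (m * m * m * m)).
      { unfold m. rewrite <- !Rpower_plus. f_equal. unfold delta. field. }
      fold B. replace (c * (c * B)) with (C1 * Rpower (IZR M) eps)
        by (rewrite Em; unfold C1, c; ring).
      nra. }
  replace ((C1 + 1) * (2 * 2) * Rpower (IZR M) eps)
    with ((C1 + 1) * Rpower (IZR M) eps * (2 * 2)) by ring.
  apply (card_le_inj _ (fun y : (Z * Z) * (bool * bool) =>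
      (sol D K (fst y) /\ (0 <= fst (fst y))%Z /\ (M <= snd (fst y) < 2 * M)%Z) /\ (True /\ True))
    (fun s => ((Z.abs (fst s), Z.abs (snd s)), (Z.leb 0 (fst s), Z.leb 0 (snd s))))).
  - intros [x m] [E Hm]. unfold sol in *. simpl in *. repeat split; lia.
  - intros [x m] [x' m'] _ _ H. simpl in H. injection H as H1 H2 H3 H4.
    destruct (Z.leb_spec 0 x), (Z.leb_spec 0 x'); try discriminate;
    destruct (Z.leb_spec 0 m), (Z.leb_spec 0 m'); try discriminate; f_equal; lia.
  - apply (card_le_prod (fun s => sol D K s /\ (0 <= fst s)%Z /\ (M <= snd s < 2 * M)%Z)
      (fun _ : bool * bool => True /\ True) _ _ Hpos).
    apply (card_le_prod (fun _ : bool => True) (fun _ : bool => True)); apply card_le_bool.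
Qed.

Lemma wpow_pos (mu : R) (m : Z) : 0 < wpow mu m.
Proof. apply Rinv_0_lt_compat, exp_pos. Qed.

Lemma pow2_exceeds (l : list (Z * Z)) :
  exists J : nat, forall s, In s l -> (Z.abs (snd s) < 2 ^ Z.of_nat J)%Z.
Proof.
  induction l as [|s l [J IH]].
  - now exists 0%nat.
  - exists (Nat.max J (Z.to_nat (Z.abs (snd s)))). intros t [<-|Ht].
    + apply Z.lt_le_trans with (2 ^ Z.abs (snd s))%Z; [apply Z.pow_gt_lin_r; lia|].
      apply Z.pow_le_mono_r; lia.
    + apply Z.lt_le_trans with (1 := IH t Ht). apply Z.pow_le_mono_r; lia.
Qed.

(** The block at [M = 2^j] has at most [C M^(mu/2)] solutions, each of weight at most [M^-mu], so
    the blocks are dominated by a geometric series of ratio [rho = 2^(-mu/2)]. The essential point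
    is that the constant is independent of [K]. *)
Lemma sol_sum_bounded (D : Z) (mu : R) :
  (2 <= D)%Z -> ~ (exists k, (k * k)%Z = D) -> 0 < mu ->
  exists C, 0 < C /\ forall K l, NoDup l -> (forall s, In s l -> sol D K s /\ snd s <> 0%Z) ->
    lsum (fun s => wpow mu (snd s)) l <= C.
Proof.
  intros HD Hns Hmu.
  destruct (sol_block_count D (mu / 2) HD Hns) as (C & HC & Hcount); [lra|].
  set (rho := / Rpower 2 (mu / 2)).
  assert (H2 : 1 < Rpower 2 (mu / 2)).
  { rewrite <- (Rpower_O 2) by lra. apply Rpower_lt; lra. }
  assert (Hrho : 0 < rho < 1).
  { unfold rho. split; [apply Rinv_0_lt_compat; lra|]. rewrite <- Rinv_1.
    apply Rinv_lt_contravar; lra. }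
  exists (C / (1 - rho)). split; [apply Rdiv_lt_0_compat; lra|]. intros K.
  (* After multiplication by [1 - rho] the induction telescopes: block [J] adds at most
     [C (rho^J - rho^(J+1))]. *)
  assert (Hdy : forall (J : nat) l, NoDup l ->
    (forall s, In s l -> (sol D K s /\ snd s <> 0%Z) /\ (Z.abs (snd s) < 2 ^ Z.of_nat J)%Z) ->
    lsum (fun s => wpow mu (snd s)) l * (1 - rho) <= C * (1 - rho ^ J)).
  { induction J as [|J IH]; intros l Hl Hs.
    - destruct l as [|s l]; [simpl; lra|].
      destruct (Hs s) as [[_ H0] H1]; [now left|]. simpl Z.of_nat in H1. rewrite Z.pow_0_r in H1. lia.
    - set (M := (2 ^ Z.of_nat J)%Z) in *.
      assert (HM : (0 < M)%Z) by (apply Z.pow_pos_nonneg; lia).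
      assert (HM2 : (2 ^ Z.of_nat (S J) = 2 * M)%Z)
        by (rewrite Nat2Z.inj_succ, Z.pow_succ_r by lia; reflexivity).
      rewrite (lsum_filter_partition _ (fun s => Z.ltb (Z.abs (snd s)) M) l).
      rewrite Rmult_plus_distr_r.
      assert (I1 := IH (filter (fun s => Z.ltb (Z.abs (snd s)) M) l)).
      assert (I2 : lsum (fun s => wpow mu (snd s))
                (filter (fun s => negb (Z.ltb (Z.abs (snd s)) M)) l) <= C * rho ^ J).
      { assert (HMp : 0 < Rpower (IZR M) mu) by apply exp_pos.
        apply Rle_trans with (lsum (fun _ => / Rpower (IZR M) mu)
            (filter (fun s => negb (Z.ltb (Z.abs (snd s)) M)) l)).
        - apply lsum_le. intros s Hin. apply filter_In in Hin. destruct Hin as [_ Hin].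
          apply Bool.negb_true_iff, Z.ltb_ge in Hin. unfold wpow.
          apply Rinv_le_contravar; [easy|]. apply Rle_Rpower_l; [lra|].
          split; [now apply IZR_lt|now apply IZR_le].
        - rewrite lsum_const.
          apply Rle_trans with (C * Rpower (IZR M) (mu / 2) * / Rpower (IZR M) mu).
          + apply Rmult_le_compat_r; [left; now apply Rinv_0_lt_compat|].
            apply (Hcount K M HM); [now apply NoDup_filter|].
            intros s Hin. apply filter_In in Hin. destruct Hin as [Hin HinM].
            apply Bool.negb_true_iff, Z.ltb_ge in HinM.
            destruct (Hs s Hin) as [[E _] Hlt]. split; [easy|]. lia.
          + replace (Rpower (IZR M) mu) with (Rpower (IZR M) (mu / 2) * Rpower (IZR M) (mu / 2))
              by (rewrite <- Rpower_plus; f_equal; field).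
            assert (Hr : rho ^ J = / Rpower (IZR M) (mu / 2)).
            { unfold rho. rewrite pow_inv. f_equal. unfold M. rewrite <- pow_IZR.
              rewrite <- Rpower_pow by apply exp_pos. rewrite <- (Rpower_pow J 2) by lra.
              rewrite !Rpower_mult. f_equal. ring. }
            rewrite Hr. right. field. apply Rgt_not_eq, exp_pos. }
      assert (I3 : lsum (fun s => wpow mu (snd s))
                (filter (fun s => Z.ltb (Z.abs (snd s)) M) l) * (1 - rho) <= C * (1 - rho ^ J)).
      { apply I1; [now apply NoDup_filter|]. intros s Hin. apply filter_In in Hin.
        destruct Hin as [Hin HinM]. apply Z.ltb_lt in HinM. split; [apply (Hs s Hin)|easy]. }
      simpl pow.
      assert (lsum (fun s => wpow mu (snd s))
                (filter (fun s => negb (Z.ltb (Z.abs (snd s)) M)) l) * (1 - rho)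
              <= C * rho ^ J * (1 - rho)) by (apply Rmult_le_compat_r; lra).
      lra. }
  intros l Hl Hs. destruct (pow2_exceeds l) as [J HJ].
  apply Rmult_le_reg_r with (1 - rho); [lra|].
  apply Rle_trans with (C * (1 - rho ^ J)).
  - apply Hdy; auto.
  - replace (C / (1 - rho) * (1 - rho)) with C by (field; lra).
    assert (0 < rho ^ J) by (apply pow_lt; lra). nra.
Qed.

(** * Sums over Z *)

Fixpoint zlist (N : nat) : list Z :=
  match N with
  | O => [0%Z]
  | S k => zlist k ++ [Z.of_nat (S k); (- Z.of_nat (S k))%Z]
  end.

Lemma in_zlist (N : nat) (z : Z) : In z (zlist N) <-> (Z.abs z <= Z.of_nat N)%Z.
Proof.
  induction N as [|N IH].
  - simpl. split; [intros [<-|[]]; simpl; lia|]. intros. left. lia.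
  - change (zlist (S N)) with (zlist N ++ [Z.of_nat (S N); (- Z.of_nat (S N))%Z]).
    rewrite in_app_iff, IH. cbn [In]. lia.
Qed.

Lemma NoDup_zlist (N : nat) : NoDup (zlist N).
Proof.
  induction N as [|N IH]; [constructor; [easy|constructor]|].
  change (zlist (S N)) with (zlist N ++ [Z.of_nat (S N); (- Z.of_nat (S N))%Z]).
  apply NoDup_app; auto.
  - constructor; [cbn [In]; lia|]. constructor; [easy|constructor].
  - intros z Hz. apply in_zlist in Hz. cbn [In]. lia.
Qed.

Lemma rsymsum_lsum (g : Z -> R) (N : nat) : rsymsum g N = lsum g (zlist N).
Proof.
  induction N as [|N IH]; [simpl; lra|].
  change (zlist (S N)) with (zlist N ++ [Z.of_nat (S N); (- Z.of_nat (S N))%Z]).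
  rewrite lsum_app, <- IH. cbn [rsymsum lsum fold_right]. lra.
Qed.

Lemma rsymsum_le (g h : Z -> R) (N : nat) : (forall k, g k <= h k) -> rsymsum g N <= rsymsum h N.
Proof. intros H. rewrite !rsymsum_lsum. apply lsum_le. auto. Qed.

Lemma rsymsum_plus (g h : Z -> R) (N : nat) :
  rsymsum (fun k => g k + h k) N = rsymsum g N + rsymsum h N.
Proof. rewrite !rsymsum_lsum. apply lsum_plus. Qed.

Lemma rsymsum_scal (c : R) (g : Z -> R) (N : nat) :
  rsymsum (fun k => c * g k) N = c * rsymsum g N.
Proof. rewrite !rsymsum_lsum. apply lsum_scal. Qed.

Lemma lsum_le_rsymsum (g : Z -> R) (l : list Z) (N : nat) :
  (forall k, 0 <= g k) -> NoDup l -> (forall k, In k l -> (Z.abs k <= Z.of_nat N)%Z) ->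
  lsum g l <= rsymsum g N.
Proof.
  intros Hg Hl HN. rewrite rsymsum_lsum. apply lsum_incl; auto.
  intros k Hk. apply in_zlist. auto.
Qed.

Lemma rsymsum_growing (g : Z -> R) : (forall k, 0 <= g k) -> Un_growing (rsymsum g).
Proof.
  intros Hg N. cbn [rsymsum]. assert (H1 := Hg (Z.of_nat (S N))).
  assert (H2 := Hg (- Z.of_nat (S N))%Z). lra.
Qed.

Lemma rsymsum_cv (g : Z -> R) (B : R) :
  (forall k, 0 <= g k) -> (forall N, rsymsum g N <= B) ->
  exists l, Un_cv (rsymsum g) l /\ forall N, rsymsum g N <= l.
Proof.
  intros Hg HB. assert (Hgr := rsymsum_growing g Hg).
  destruct (growing_cv _ Hgr) as [l Hl].
  - exists B. intros x [N ->]. auto.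
  - exists l. split; auto. intros N. now apply growing_ineq.
Qed.

Lemma cv_le_bound (u : nat -> R) (l B : R) : Un_cv u l -> (forall n, u n <= B) -> l <= B.
Proof.
  intros Hl HB. destruct (Rle_lt_dec l B) as [|H]; [easy|].
  destruct (Hl (l - B)) as [N HN]; [lra|]. specialize (HN N (Nat.le_refl N)).
  unfold R_dist in HN. apply Rabs_def2 in HN. specialize (HB N). lra.
Qed.

(** [Rlim] returns 0 on a divergent sequence, so convergence is proved first: [a = (a + g) - g], and
    both series on the right have nonnegative terms and bounded partial sums. *)
Lemma rsymsum_abs_cv (a g : Z -> R) (B : R) :
  (forall k, Rabs (a k) <= g k) -> (forall N, rsymsum g N <= B) ->
  Rabs (Rlim (rsymsum a)) <= B.
Proof.
  intros Ha HB.
  assert (Hg : forall k, 0 <= g k) by (intros k; apply Rle_trans with (2 := Ha k), Rabs_pos).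
  assert (Hak : forall k, - g k <= a k <= g k).
  { intros k. specialize (Ha k). unfold Rabs in Ha. destruct Rcase_abs; lra. }
  destruct (rsymsum_cv g B Hg HB) as (lg & Hlg & _).
  destruct (rsymsum_cv (fun k => a k + g k) (B + B)) as (ls & Hls & _).
  { intros k. specialize (Hak k). lra. }
  { intros N. rewrite rsymsum_plus. specialize (HB N).
    assert (rsymsum a N <= rsymsum g N) by (apply rsymsum_le; apply Hak). lra. }
  assert (Hcv : Un_cv (rsymsum a) (ls - lg)).
  { apply Un_cv_ext with (fun N => rsymsum (fun k => a k + g k) N - rsymsum g N).
    - intros N. rewrite rsymsum_plus. ring.
    - now apply CV_minus. }
  unfold Rlim. destruct excluded_middle_informative as [H|H]; [|elim H; eauto].
  destruct (constructive_indefinite_description _ H) as [l Hl]. simpl.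
  assert (Hb : forall N, - B <= rsymsum a N <= B).
  { intros N. specialize (HB N).
    assert (rsymsum a N <= rsymsum g N) by (apply rsymsum_le; apply Hak).
    assert (- rsymsum g N <= rsymsum a N); [|lra].
    replace (- rsymsum g N) with (-1 * rsymsum g N) by ring. rewrite <- rsymsum_scal.
    apply rsymsum_le. intros k. specialize (Hak k). lra. }
  apply Rabs_le. split.
  - assert (- l <= B); [|lra]. apply cv_le_bound with (fun N => - rsymsum a N).
    + now apply (CV_opp (rsymsum a)).
    + intros N. specialize (Hb N). lra.
  - apply cv_le_bound with (rsymsum a); auto. apply Hb.
Qed.

(** * Pointwise bounds for the complex-valued operator *)

Lemma Cmod_nonneg (z : Cx) : 0 <= Cmod z.
Proof. apply sqrt_pos. Qed.

Lemma fst_le_Cmod (z : Cx) : Rabs (fst z) <= Cmod z.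
Proof.
  unfold Cmod. rewrite <- sqrt_Rsqr_abs. apply sqrt_le_1_alt. unfold Rsqr.
  assert (0 <= snd z ^ 2) by apply pow2_ge_0. simpl in *. lra.
Qed.

Lemma snd_le_Cmod (z : Cx) : Rabs (snd z) <= Cmod z.
Proof.
  unfold Cmod. rewrite <- sqrt_Rsqr_abs. apply sqrt_le_1_alt. unfold Rsqr.
  assert (0 <= fst z ^ 2) by apply pow2_ge_0. simpl in *. lra.
Qed.

Lemma Cmod_le_sum (z : Cx) : Cmod z <= Rabs (fst z) + Rabs (snd z).
Proof.
  unfold Cmod. assert (H1 := Rabs_pos (fst z)). assert (H2 := Rabs_pos (snd z)).
  rewrite <- (sqrt_square (Rabs (fst z) + Rabs (snd z))) by lra.
  apply sqrt_le_1_alt. rewrite <- (pow2_abs (fst z)), <- (pow2_abs (snd z)). nra.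
Qed.

Definition Iterm (w : Z -> R) (a b c : Z) (F : Z -> R) (n m : Z) : R :=
  if Z.eq_dec m 0 then 0 else F (qform a b c m n) * w m.

(** Real and imaginary parts are limits taken separately, each at most [B] in absolute value; adding
    them costs the factor 2, which only affects constants. *)
Lemma Iop_bound (w : Z -> R) (a b c : Z) (f : Z -> Cx) (n : Z) (B : R) :
  (forall m, 0 <= w m) ->
  (forall N, rsymsum (Iterm w a b c (fun k => Cmod (f k)) n) N <= B) ->
  Cmod (Iop w a b c f n) <= 2 * B.
Proof.
  intros Hw HB. eapply Rle_trans; [apply Cmod_le_sum|].
  assert (H1 : Rabs (fst (Iop w a b c f n)) <= B).
  { apply (rsymsum_abs_cv _ _ B) with (2 := HB). intros m. unfold Iterm.
    destruct Z.eq_dec; simpl; [rewrite Rabs_R0; lra|].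
    rewrite Rabs_mult, (Rabs_right (w m)) by (apply Rle_ge, Hw).
    rewrite Rmult_comm. apply Rmult_le_compat_r; [apply Hw|apply fst_le_Cmod]. }
  assert (H2 : Rabs (snd (Iop w a b c f n)) <= B).
  { apply (rsymsum_abs_cv _ _ B) with (2 := HB). intros m. unfold Iterm.
    destruct Z.eq_dec; simpl; [rewrite Rabs_R0; lra|].
    rewrite Rabs_mult, (Rabs_right (w m)) by (apply Rle_ge, Hw).
    rewrite Rmult_comm. apply Rmult_le_compat_r; [apply Hw|apply snd_le_Cmod]. }
  lra.
Qed.

(** * Suprema and sums in the extended half-line *)

Lemma Rsup_lub (E : R -> Prop) (s : R) : Rsup E = Fin s -> is_lub E s.
Proof.
  unfold Rsup. destruct excluded_middle_informative as [H|H]; [|discriminate].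
  intros Es. injection Es as <-. apply proj2_sig.
Qed.

Lemma Rsup_bounded (E : R -> Prop) (B : R) :
  (exists x, E x) -> (forall x, E x -> x <= B) -> exists s, Rsup E = Fin s /\ is_lub E s.
Proof.
  intros Hne HB. unfold Rsup. destruct excluded_middle_informative as [H|H].
  - eexists. split; [reflexivity|]. apply proj2_sig.
  - elim H. split; [exists B; exact HB|easy].
Qed.

Lemma Rbar_sup_upper (E : Rbar -> Prop) (s x : R) : Rbar_sup E = Fin s -> E (Fin x) -> x <= s.
Proof.
  unfold Rbar_sup. destruct excluded_middle_informative as [H|H]; [discriminate|].
  intros Es Hx. apply Rsup_lub in Es. now apply Es.
Qed.

Lemma Rbar_sup_PInf (E : Rbar -> Prop) : E PInf -> Rbar_sup E = PInf.
Proof. unfold Rbar_sup. now destruct excluded_middle_informative. Qed.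

Lemma Rbar_sup_bounded (E : Rbar -> Prop) (B : R) :
  (exists x, E (Fin x)) -> ~ E PInf -> (forall x, E (Fin x) -> x <= B) ->
  exists s, Rbar_sup E = Fin s /\ s <= B.
Proof.
  intros Hne Hinf HB. unfold Rbar_sup. destruct excluded_middle_informative as [H|H]; [easy|].
  destruct (Rsup_bounded (fun x => E (Fin x)) B Hne HB) as (s & Es & Hs).
  exists s. split; [easy|]. apply Hs. exact HB.
Qed.

Lemma symsum_Fin (g : Z -> R) (N : nat) : symsum (fun k => Fin (g k)) N = Fin (rsymsum g N).
Proof. induction N as [|N IH]; [reflexivity|]. cbn [symsum rsymsum]. rewrite IH. reflexivity. Qed.

Lemma sumZ_upper (g : Z -> R) (s : R) (N : nat) :
  sumZ (fun k => Fin (g k)) = Fin s -> rsymsum g N <= s.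
Proof.
  intros H. apply (Rbar_sup_upper _ _ _ H). exists N. now rewrite symsum_Fin.
Qed.

Lemma sumZ_bounded (g : Z -> R) (B : R) :
  (forall N, rsymsum g N <= B) -> exists s, sumZ (fun k => Fin (g k)) = Fin s /\ s <= B.
Proof.
  intros HB. apply Rbar_sup_bounded.
  - exists (rsymsum g 0), 0%nat. reflexivity.
  - intros [N HN]. now rewrite symsum_Fin in HN.
  - intros x [N HN]. rewrite symsum_Fin in HN. injection HN as ->. auto.
Qed.

Lemma sumZ_ext (g h : Z -> Rbar) : (forall k, g k = h k) -> sumZ g = sumZ h.
Proof. intros H. f_equal. now apply functional_extensionality. Qed.

Lemma IopE_sumZ (w : Z -> R) (a b c : Z) (F : Z -> R) (n : Z) :
  IopE w a b c F n = sumZ (fun m => Fin (Iterm w a b c F n m)).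
Proof. apply sumZ_ext. intros m. unfold Iterm. now destruct Z.eq_dec. Qed.

(** * Power inequalities *)

Lemma rpow_pos_eq (x e : R) : 0 < x -> rpow x e = Rpower x e.
Proof. intros H. unfold rpow. destruct Rlt_dec; [easy|contradiction]. Qed.

Lemma rpow_0 (e : R) : rpow 0 e = 0.
Proof. unfold rpow. destruct Rlt_dec; [lra|easy]. Qed.

Lemma rpow_nonneg (x e : R) : 0 <= rpow x e.
Proof. unfold rpow. destruct Rlt_dec; [left; apply exp_pos|lra]. Qed.

Lemma rpow_le (x y e : R) : 0 <= e -> x <= y -> rpow x e <= rpow y e.
Proof.
  intros He Hxy. unfold rpow at 1. destruct Rlt_dec as [Hx|Hx]; [|apply rpow_nonneg].
  rewrite rpow_pos_eq by lra. apply Rle_Rpower_l; lra.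
Qed.

Lemma rpow_rpow (x e e' : R) : 0 <= x -> rpow (rpow x e) e' = rpow x (e * e').
Proof.
  intros [Hx|<-].
  - rewrite !(rpow_pos_eq x) by easy. rewrite rpow_pos_eq by apply exp_pos. apply Rpower_mult.
  - now rewrite !rpow_0.
Qed.

Lemma rpow_1 (x : R) : 0 <= x -> rpow x 1 = x.
Proof.
  intros [Hx|<-]; [|apply rpow_0]. rewrite rpow_pos_eq by easy. now apply Rpower_1.
Qed.

Lemma rpow_mult (x y e : R) : 0 <= x -> 0 <= y -> rpow (x * y) e = rpow x e * rpow y e.
Proof.
  intros [Hx|<-] [Hy|<-]; rewrite ?Rmult_0_l, ?Rmult_0_r, ?rpow_0; try ring.
  rewrite !rpow_pos_eq by (try apply Rmult_lt_0_compat; easy). symmetry.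
  now apply Rpower_mult_distr.
Qed.

(** With [x = exp z], both [x^p = exp z * exp ((p - 1) z) >= exp z * (1 + (p - 1) z)] and
    [exp z * (1 - z) <= 1] follow from [1 + v <= exp v]; the second, times [p - 1], completes the
    first. *)
Lemma bernoulli (x p : R) : 0 < x -> 1 <= p -> 1 + p * (x - 1) <= Rpower x p.
Proof.
  intros Hx Hp. unfold Rpower. set (z := ln x). rewrite <- (exp_ln x) by easy. fold z.
  assert (H1 : exp z * (1 + (p - 1) * z) <= exp (p * z)).
  { replace (p * z) with (z + (p - 1) * z) by ring. rewrite exp_plus.
    apply Rmult_le_compat_l; [left; apply exp_pos|apply exp_ineq1_le]. }
  assert (H2 : exp z * (1 - z) <= 1).
  { replace 1 with (exp z * exp (- z)) at 2 by (rewrite <- exp_plus, Rplus_opp_r; apply exp_0).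
    apply Rmult_le_compat_l; [left; apply exp_pos|].
    replace (1 - z) with (1 + - z) by ring. apply exp_ineq1_le. }
  nra.
Qed.

(** The left side is the tangent line of [t^p] at [t = s]; for [t > 0] this is Bernoulli's
    inequality for [t / s]. *)
Lemma rpow_tangent (s t p : R) : 0 < s -> 0 <= t -> 1 <= p ->
  Rpower s p * (1 + p * (t / s - 1)) <= rpow t p.
Proof.
  intros Hs [Ht|<-] Hp.
  - rewrite rpow_pos_eq by easy. replace t with (s * (t / s)) at 2 by (field; lra).
    assert (Hts : 0 < t / s) by (now apply Rdiv_lt_0_compat).
    rewrite <- Rpower_mult_distr by easy.
    apply Rmult_le_compat_l; [left; apply exp_pos|]. now apply bernoulli.
  - rewrite rpow_0. assert (0 < Rpower s p) by apply exp_pos.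
    replace (0 / s) with 0 by (field; lra). nra.
Qed.

(** The tangent inequality is taken at the point [s = T / U] and summed against the weights [u]. The
    weights have total at most [U], not exactly [U]. *)
Lemma jensen {A : Type} (u t : A -> R) (l : list A) (U p : R) :
  1 <= p -> 0 < U -> (forall x, In x l -> 0 <= u x) -> (forall x, In x l -> 0 <= t x) ->
  lsum u l <= U ->
  rpow (lsum (fun x => u x * t x) l) p <= Rpower U (p - 1) * lsum (fun x => u x * rpow (t x) p) l.
Proof.
  intros Hp HU Hu Ht HuU. set (T := lsum (fun x => u x * t x) l).
  set (Y := lsum (fun x => u x * rpow (t x) p) l).
  assert (HY : 0 <= Y).
  { apply lsum_nonneg. intros x Hx. apply Rmult_le_pos; [auto|apply rpow_nonneg]. }
  assert (HT : 0 <= T) by (apply lsum_nonneg; intros x Hx; apply Rmult_le_pos; auto).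
  destruct HT as [HT|HT].
  2:{ rewrite <- HT, rpow_0. apply Rmult_le_pos; [left; apply exp_pos|easy]. }
  set (s := T / U). assert (Hs : 0 < s) by (now apply Rdiv_lt_0_compat).
  assert (Hsp : 0 < Rpower s p) by apply exp_pos.
  assert (H1 : Rpower s p * ((1 - p) * lsum u l + p / s * T) <= Y).
  { unfold T. rewrite <- !lsum_scal, <- lsum_plus, <- lsum_scal. apply lsum_le.
    intros x Hx. assert (H := rpow_tangent s (t x) p Hs (Ht x Hx) Hp).
    apply Rmult_le_compat_l with (r := u x) in H; [|auto].
    replace (Rpower s p * ((1 - p) * u x + p / s * (u x * t x)))
      with (u x * (Rpower s p * (1 + p * (t x / s - 1)))) by (field; lra). easy. }
  (* The total weight carries the coefficient [1 - p <= 0], so its upper bound [U] gives a lower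
     bound here. *)
  assert (H2 : U <= (1 - p) * lsum u l + p / s * T).
  { replace (p / s * T) with (p * U) by (unfold s; field; lra). nra. }
  assert (H3 : Rpower s p * U <= Y).
  { apply Rle_trans with (2 := H1). apply Rmult_le_compat_l; lra. }
  rewrite rpow_pos_eq by easy. replace T with (s * U) by (unfold s; field; lra).
  rewrite <- Rpower_mult_distr by easy.
  replace (Rpower U p) with (U * Rpower U (p - 1)).
  2:{ rewrite <- (Rpower_1 U) at 1 by easy. rewrite <- Rpower_plus. f_equal. ring. }
  replace (Rpower s p * (U * Rpower U (p - 1))) with (Rpower U (p - 1) * (Rpower s p * U)) by ring.
  apply Rmult_le_compat_l; [left; apply exp_pos|easy].
Qed.

(** * Comparison of series with telescoping sums *)

Lemma Rpower_neg_tangent (a b s : R) : 0 < a -> 0 < b -> 0 < s ->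
  s * ((b - a) * Rpower b (- (1 + s))) <= Rpower a (- s) - Rpower b (- s).
Proof.
  intros Ha Hb Hs. assert (Hab : 0 < a / b) by (now apply Rdiv_lt_0_compat).
  assert (H1 : 1 - s * (a / b - 1) <= Rpower (a / b) (- s)).
  { assert (H2 : ln (a / b) <= a / b - 1).
    { assert (H := exp_ineq1_le (ln (a / b))). rewrite exp_ln in H by easy. lra. }
    apply Rle_trans with (1 + - s * ln (a / b)); [nra|apply exp_ineq1_le]. }
  assert (Hbs : 0 < Rpower b (- s)) by apply exp_pos.
  apply Rmult_le_compat_l with (r := Rpower b (- s)) in H1; [|lra].
  rewrite Rpower_mult_distr in H1 by easy.
  replace (b * (a / b)) with a in H1 by (field; lra).
  replace (Rpower b (- (1 + s))) with (Rpower b (- s) / b).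
  2:{ replace (- (1 + s)) with (- s + - (1)) by ring. rewrite Rpower_plus, (Rpower_Ropp b 1).
      rewrite Rpower_1 by easy. reflexivity. }
  replace (s * ((b - a) * (Rpower b (- s) / b)))
    with (Rpower b (- s) * (1 - s * (a / b - 1)) - Rpower b (- s)) by (field; lra). lra.
Qed.

(** An integral test in discrete form: by convexity of [x^-s], each term after the first is at most
    the drop of [b^-s / s]. It is used with [b k = k], [d k = 1] and with [b k = 1 + log k],
    [d k = 1/k]. *)
Lemma sum_neg_power_bounded (b d : nat -> R) (s : R) (n : nat) :
  0 < s -> (forall k, (1 <= k)%nat -> 0 < b k) ->
  (forall k, (1 <= k)%nat -> 0 <= d k) ->
  (forall k, (1 <= k)%nat -> d (S k) <= b (S k) - b k) ->
  lsum (fun k => d k * Rpower (b k) (- (1 + s))) (seq 1 n) <=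
  d 1%nat * Rpower (b 1%nat) (- (1 + s)) + / s * Rpower (b 1%nat) (- s).
Proof.
  intros Hs Hb Hd Hdb.
  assert (His : 0 < / s) by (now apply Rinv_0_lt_compat).
  assert (Hind : forall n, lsum (fun k => d k * Rpower (b k) (- (1 + s))) (seq 1 (S n)) <=
    d 1%nat * Rpower (b 1%nat) (- (1 + s))
    + / s * (Rpower (b 1%nat) (- s) - Rpower (b (S n)) (- s))).
  { clear n. induction n as [|n IH].
    - simpl. lra.
    - rewrite seq_S, lsum_app. change (1 + S n)%nat with (S (S n)).
      set (k := S n) in *. assert (Hk : (1 <= k)%nat) by (unfold k; lia). clearbody k.
      assert (H := Rpower_neg_tangent (b k) (b (S k)) s (Hb k Hk) (Hb (S k) ltac:(lia)) Hs).
      apply Rmult_le_compat_l with (r := / s) in H; [|lra].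
      rewrite <- Rmult_assoc, Rinv_l, Rmult_1_l in H by lra.
      assert (H' : d (S k) * Rpower (b (S k)) (- (1 + s))
                <= (b (S k) - b k) * Rpower (b (S k)) (- (1 + s))).
      { apply Rmult_le_compat_r; [left; apply exp_pos|auto]. }
      cbn [lsum fold_right]. lra. }
  assert (H0 : 0 < Rpower (b 1%nat) (- s)) by apply exp_pos.
  destruct n as [|n].
  - simpl. assert (0 <= d 1%nat * Rpower (b 1%nat) (- (1 + s))).
    { apply Rmult_le_pos; [auto|left; apply exp_pos]. }
    assert (0 < / s * Rpower (b 1%nat) (- s)) by (now apply Rmult_lt_0_compat). lra.
  - apply Rle_trans with (1 := Hind n).
    assert (0 < Rpower (b (S n)) (- s)) by apply exp_pos. nra.
Qed.

Lemma rsymsum_even (h : nat -> R) (g : Z -> R) (N : nat) :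
  g 0%Z = 0 -> (forall k, (1 <= k)%nat -> g (Z.of_nat k) = h k) ->
  (forall k, (1 <= k)%nat -> g (- Z.of_nat k)%Z = h k) ->
  rsymsum g N = 2 * lsum h (seq 1 N).
Proof.
  intros H0 H1 H2. induction N as [|N IH]; [simpl; lra|].
  cbn [rsymsum]. rewrite seq_S, lsum_app, IH, H1, H2 by lia. simpl. lra.
Qed.

Lemma inverse_power_sum_bounded (nu : R) : 1 < nu ->
  exists U, 0 < U /\ forall N,
    rsymsum (fun m => if Z.eq_dec m 0 then 0 else wpow nu m) N <= U.
Proof.
  intros Hnu. set (s := nu - 1). assert (Hs : 0 < s) by (unfold s; lra).
  assert (His : 0 < / s) by (now apply Rinv_0_lt_compat).
  exists (2 * (1 + / s)). split; [lra|]. intros N.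
  rewrite (rsymsum_even (fun k => 1 * Rpower (INR k) (- (1 + s)))); [|easy| |].
  - apply Rmult_le_compat_l; [lra|].
    eapply Rle_trans; [apply (sum_neg_power_bounded INR (fun _ => 1) s N Hs)|].
    + intros k Hk. now apply lt_0_INR.
    + intros; lra.
    + intros k _. rewrite S_INR. lra.
    + simpl INR. unfold Rpower. rewrite ln_1, !Rmult_0_r, exp_0. lra.
  - intros k Hk. destruct Z.eq_dec; [lia|]. unfold wpow.
    rewrite Z.abs_eq, <- INR_IZR_INZ, Rpower_Ropp, Rmult_1_l by lia. f_equal. f_equal. unfold s. ring.
  - intros k Hk. destruct Z.eq_dec; [lia|]. unfold wpow.
    rewrite Z.abs_opp, Z.abs_eq, <- INR_IZR_INZ, Rpower_Ropp, Rmult_1_l by lia.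
    f_equal. f_equal. unfold s. ring.
Qed.

(** * Boundedness *)

Lemma lsum_filter_zero {A : Type} (f : A -> R) (t : A -> bool) (l : list A) :
  (forall x, t x = false -> f x = 0) -> lsum f l = lsum f (filter t l).
Proof.
  intros H. induction l as [|a l IH]; simpl; [reflexivity|].
  destruct (t a) eqn:E; simpl; [lra|]. rewrite (H a E). lra.
Qed.

Lemma abs_bound_exists {A : Type} (h : A -> Z) (l : list A) :
  exists N : nat, forall x, In x l -> (Z.abs (h x) <= Z.of_nat N)%Z.
Proof.
  induction l as [|a l [N IH]]; [now exists 0%nat|].
  exists (Nat.max N (Z.to_nat (Z.abs (h a)))). intros x [<-|Hx]; [lia|].
  specialize (IH x Hx). lia.
Qed.

Lemma NoDup_list_prod {A B : Type} (l : list A) (l' : list B) :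
  NoDup l -> NoDup l' -> NoDup (list_prod l l').
Proof.
  intros Hl Hl'. induction Hl as [|a l Ha Hl IH]; simpl; [constructor|].
  apply NoDup_app; auto.
  - apply FinFun.Injective_map_NoDup; [|easy]. intros x y E. congruence.
  - intros [x y] Hx Hy. apply in_map_iff in Hx. destruct Hx as (z & E & _).
    apply in_prod_iff in Hy. injection E as <- _. tauto.
Qed.

(** This is the case [p = 1] for finite truncations. The pairs [(n, m)] are sorted by the value [k]
    of the form; the coefficient of [G k] is then a sum of [|m|^-mu] over solutions, bounded
    uniformly in [k]. *)
Lemma form_fiber_sum_bounded (D : Z) (mu : R) :
  (0 < D)%Z -> ~ (exists k, (k * k)%Z = D) -> 0 < mu ->
  exists C, 0 < C /\ forall a b c, qdisc a b c = D ->
    forall (G : Z -> R) (Y : R), (forall k, 0 <= G k) -> (forall N, rsymsum G N <= Y) ->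
    forall M N, rsymsum (fun n => rsymsum (Iterm (wpow mu) a b c G n) M) N <= C * Y.
Proof.
  intros HD0 Hns Hmu.
  assert (HD : (2 <= D)%Z).
  { destruct (Z.eq_dec D 1) as [->|]; [elim Hns; now exists 1%Z|lia]. }
  destruct (sol_sum_bounded D mu HD Hns Hmu) as (C & HC & Hsum).
  exists C. split; [easy|]. intros a b c Hdisc G Y HG HY M N.
  (* With [c = 0] the discriminant would be the square [b^2]. This makes [phi] below injective. *)
  assert (Hc : c <> 0%Z).
  { intros ->. apply Hns. exists b. rewrite <- Hdisc. unfold qdisc. ring. }
  set (F := fun s : Z * Z => Iterm (wpow mu) a b c G (fst s) (snd s)).
  set (L := filter (fun s : Z * Z => negb (Z.eqb (snd s) 0)) (list_prod (zlist N) (zlist M))).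
  assert (EL : rsymsum (fun n => rsymsum (Iterm (wpow mu) a b c G n) M) N = lsum F L).
  { unfold L. rewrite <- lsum_filter_zero.
    - rewrite rsymsum_lsum, lsum_list_prod. apply lsum_ext. intros n _. apply rsymsum_lsum.
    - intros [n m] H. simpl in H. apply Bool.negb_false_iff, Z.eqb_eq in H.
      unfold F, Iterm. simpl. now destruct Z.eq_dec. }
  rewrite EL.
  assert (HL : forall s, In s L -> snd s <> 0%Z).
  { intros s Hs. apply filter_In in Hs. destruct Hs as [_ Hs].
    apply Bool.negb_true_iff in Hs. now apply Z.eqb_neq. }
  assert (HLd : NoDup L) by (apply NoDup_filter, NoDup_list_prod; apply NoDup_zlist).
  set (h := fun s : Z * Z => qform a b c (snd s) (fst s)).
  destruct (abs_bound_exists h L) as [K HK].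
  eapply Rle_trans; [apply (lsum_fibers F h L (zlist K))|].
  - intros s _. unfold F, Iterm. destruct Z.eq_dec; [lra|].
    apply Rmult_le_pos; [apply HG|left; apply wpow_pos].
  - intros s Hs. apply in_zlist. auto.
  - apply Rle_trans with (lsum (fun k => C * G k) (zlist K)).
    2:{ rewrite lsum_scal, <- rsymsum_lsum. apply Rmult_le_compat_l; [lra|auto]. }
    apply lsum_le. intros k _. set (Lk := filter (fun s => classical_eqb (h s) k) L).
    assert (HLk : forall s, In s Lk -> h s = k /\ snd s <> 0%Z).
    { intros s Hs. apply filter_In in Hs. destruct Hs as [Hs Hs'].
      split; [now apply classical_eqb_true|auto]. }
    rewrite (lsum_ext F (fun s => G k * wpow mu (snd s))).
    2:{ intros s Hs. destruct (HLk s Hs) as [<- Hs0]. unfold F, Iterm. now destruct Z.eq_dec. }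
    rewrite lsum_scal, Rmult_comm. apply Rmult_le_compat_r; [apply HG|].
    set (phi := fun s : Z * Z => (2 * c * fst s + b * snd s, snd s)%Z).
    apply Rle_trans with (lsum (fun s => wpow mu (snd s)) (map phi Lk)).
    + rewrite lsum_map. right. now apply lsum_ext.
    + apply (Hsum (4 * c * k)%Z).
      * apply FinFun.Injective_map_NoDup; [|now apply NoDup_filter].
        intros [n m] [n' m'] E. assert (E2 : m = m') by exact (f_equal snd E).
        assert (E1 : (2 * c * n + b * m = 2 * c * n' + b * m')%Z) by exact (f_equal fst E).
        subst m'. f_equal.
        apply Z.mul_reg_l with (2 * c)%Z; lia.
      * intros s Hs. apply in_map_iff in Hs. destruct Hs as ([n m] & <- & Hs).
        destruct (HLk _ Hs) as [E Hm]. split; [|easy].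
        unfold sol, phi. unfold h, qform in E. cbn [fst snd] in *.
        rewrite <- E, <- Hdisc. unfold qdisc. ring.
Qed.

Lemma rsymsum_cv_sum (u : nat -> Z -> R) (T : Z -> R) (N : nat) :
  (forall n, Un_cv (fun M => u M n) (T n)) ->
  Un_cv (fun M => rsymsum (u M) N) (rsymsum T N).
Proof.
  intros H. induction N as [|N IH]; [apply H|].
  apply (CV_plus (fun M => rsymsum (u M) N)
     (fun M => u M (Z.of_nat (S N)) + u M (- Z.of_nat (S N))%Z)); [easy|].
  apply CV_plus; apply H.
Qed.

Lemma Iterm_nonneg (w : Z -> R) (a b c : Z) (F : Z -> R) (n m : Z) :
  (forall m, 0 <= w m) -> (forall k, 0 <= F k) -> 0 <= Iterm w a b c F n m.
Proof.
  intros Hw HF. unfold Iterm. destruct Z.eq_dec; [lra|]. apply Rmult_le_pos; auto.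
Qed.

Lemma IopE_finite (w : Z -> R) (a b c : Z) (F : Z -> R) (n : Z) (B : R) :
  (forall N, rsymsum (Iterm w a b c F n) N <= B) -> IopE w a b c F n <> PInf.
Proof.
  intros H. rewrite IopE_sumZ. destruct (sumZ_bounded _ B H) as (s & -> & _). discriminate.
Qed.

Lemma bounded_linf (lam : R) : 1 < lam ->
  exists C, 0 <= C /\ forall (a b c : Z) (f : Z -> Cx) (y : R), lpnorm ExpInf f = Fin y ->
    (forall n : Z, IopE (wpow lam) a b c (fun k => Cmod (f k)) n <> PInf) /\
    exists x : R, lpnorm ExpInf (Iop (wpow lam) a b c f) = Fin x /\ x <= C * y.
Proof.
  intros Hlam. destruct (inverse_power_sum_bounded lam Hlam) as (U & HU & HUN).
  exists (2 * U). split; [lra|]. intros a b c f y Hy.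
  assert (Hf : forall k, Cmod (f k) <= y) by (intros k; apply (Rbar_sup_upper _ _ _ Hy); eauto).
  assert (Hy0 : 0 <= y) by (apply Rle_trans with (2 := Hf 0%Z), Cmod_nonneg).
  assert (HB : forall n N,
    rsymsum (Iterm (wpow lam) a b c (fun k => Cmod (f k)) n) N <= U * y).
  { intros n N.
    apply Rle_trans with (rsymsum (fun m => y * (if Z.eq_dec m 0 then 0 else wpow lam m)) N).
    - apply rsymsum_le. intros m. unfold Iterm. destruct Z.eq_dec; [lra|].
      apply Rmult_le_compat_r; [left; apply wpow_pos|apply Hf].
    - rewrite rsymsum_scal, Rmult_comm. apply Rmult_le_compat_r; auto. }
  split.
  - intros n. now apply IopE_finite with (U * y).
  - apply Rbar_sup_bounded.
    + exists (Cmod (Iop (wpow lam) a b c f 0)), 0%Z. reflexivity.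
    + intros [k Hk]. discriminate.
    + intros x [k Hk]. injection Hk as ->. rewrite Rmult_assoc. apply Iop_bound; auto.
      intros m. left. apply wpow_pos.
Qed.

(* Write [|f(q)| |m|^-lam = |m|^-nu (|f(q)| |m|^(nu - lam))] with [nu > 1], so that Jensen's
   inequality for the weights [|m|^-nu] reduces the bound to the case [p = 1] with [|f|^p] and
   the positive exponent [mu = p lam - (p - 1) nu]. *)
Lemma bounded_lp (p lam : R) (D : Z) :
  1 <= p -> 1 - / p < lam -> (0 < D)%Z -> ~ (exists k, (k * k)%Z = D) ->
  exists C, 0 <= C /\ forall (a b c : Z) (f : Z -> Cx) (y : R), qdisc a b c = D ->
    lpnorm (ExpFin p) f = Fin y ->
    (forall n : Z, IopE (wpow lam) a b c (fun k => Cmod (f k)) n <> PInf) /\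
    exists x : R, lpnorm (ExpFin p) (Iop (wpow lam) a b c f) = Fin x /\ x <= C * y.
Proof.
  intros Hp Hlam HD Hns.
  assert (Hpl : 0 < p * lam - (p - 1)).
  { apply Rmult_lt_compat_l with (r := p) in Hlam; [|lra].
    rewrite Rmult_minus_distr_l, Rinv_r in Hlam; lra. }
  set (delta := (p * lam - (p - 1)) / p).
  assert (Hdelta : 0 < delta) by (apply Rdiv_lt_0_compat; lra).
  assert (Hpd : p * delta = p * lam - (p - 1)) by (unfold delta; field; lra).
  (* [delta] is the gap [lam - (1 - 1/p)]; for this [nu] the exponent [mu] equals [delta]. *)
  set (nu := 1 + delta). set (mu := p * lam - (p - 1) * nu).
  assert (Hmu : 0 < mu) by (unfold mu, nu; nra).
  destruct (inverse_power_sum_bounded nu) as (U & HU & HUN); [unfold nu; lra|].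
  destruct (form_fiber_sum_bounded D mu HD Hns Hmu) as (C & HC & Hsum).
  set (UC := Rpower U (p - 1)). assert (HUC : 0 < UC) by apply exp_pos.
  (* The three factors come from [Iop_bound], from Jensen's inequality and from the case [p = 1]. *)
  set (A := rpow 2 p * UC * C).
  assert (HA : 0 <= A).
  { apply Rmult_le_pos; [apply Rmult_le_pos; [apply rpow_nonneg|lra]|lra]. }
  assert (Hip : 0 < / p) by (apply Rinv_0_lt_compat; lra).
  exists (rpow A (/ p)). split; [apply rpow_nonneg|]. intros a b c f y Hdisc Hy.
  set (F := fun k => Cmod (f k)).
  assert (HF : forall k, 0 <= F k) by (intros k; apply Cmod_nonneg).
  set (G := fun k => rpow (F k) p).
  assert (HG : forall k, 0 <= G k) by (intros k; apply rpow_nonneg).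
  unfold lpnorm, lpnormE in Hy.
  change (Rbar_rpow (sumZ (fun k => Fin (G k))) (/ p) = Fin y) in Hy.
  destruct (sumZ (fun k => Fin (G k))) as [Y|] eqn:EY; [|discriminate].
  simpl in Hy. injection Hy as <-.
  assert (HGY : forall N, rsymsum G N <= Y) by (intros N; now apply sumZ_upper).
  assert (HY0 : 0 <= Y).
  { apply Rle_trans with (2 := HGY 0%nat). apply HG. }
  assert (Hw : forall mu m, 0 <= wpow mu m) by (intros; left; apply wpow_pos).
  set (g := Iterm (wpow mu) a b c G).
  assert (Hg : forall n m, 0 <= g n m) by (intros; apply Iterm_nonneg; auto).
  assert (Hgsum : forall M N, rsymsum (fun n => rsymsum (g n) M) N <= C * Y)
    by (intros M N; now apply Hsum).
  assert (Hg1 : forall n M, rsymsum (g n) M <= C * Y).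
  { intros n M. apply Rle_trans with (2 := Hgsum M (Z.to_nat (Z.abs n))).
    replace (rsymsum (g n) M) with (lsum (fun n => rsymsum (g n) M) [n]) by (simpl; lra).
    apply lsum_le_rsymsum.
    - intros k. rewrite rsymsum_lsum. apply lsum_nonneg. auto.
    - constructor; [easy|constructor].
    - intros k [<-|[]]. lia. }
  (* Each row converges, being part of a bounded double sum of nonnegative terms, and [T n] is its
     full sum. Letting [M] grow with [N] fixed then carries the double bound over to [T]. *)
  assert (HT : exists T, forall n, Un_cv (rsymsum (g n)) (T n) /\
                forall M, rsymsum (g n) M <= T n).
  { exists (fun n => proj1_sig (constructive_indefinite_description _
        (rsymsum_cv (g n) (C * Y) (Hg n) (Hg1 n)))).
    intros n. apply (proj2_sig (constructive_indefinite_description _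
        (rsymsum_cv (g n) (C * Y) (Hg n) (Hg1 n)))). }
  destruct HT as [T HT].
  assert (HT0 : forall n, 0 <= T n).
  { intros n. apply Rle_trans with (2 := proj2 (HT n) 0%nat). apply Hg. }
  assert (HTsum : forall N, rsymsum T N <= C * Y).
  { intros N. apply cv_le_bound with (fun M => rsymsum (fun n => rsymsum (g n) M) N); auto.
    apply (rsymsum_cv_sum (fun M n => rsymsum (g n) M)). intros n. apply HT. }
  set (S := fun n => rpow (UC * T n) (/ p)).
  assert (HUT : forall n, 0 <= UC * T n) by (intros n; apply Rmult_le_pos; auto; lra).
  assert (HS : forall n M, rsymsum (Iterm (wpow lam) a b c F n) M <= S n).
  { intros n M.
    set (u := fun m => if Z.eq_dec m 0 then 0 else wpow nu m).
    set (t := fun m => F (qform a b c m n) * Rpower (IZR (Z.abs m)) (nu - lam)).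
    assert (Hu : forall m, 0 <= u m) by (intros m; unfold u; destruct Z.eq_dec; [lra|auto]).
    assert (Ht : forall m, 0 <= t m)
      by (intros m; apply Rmult_le_pos; [auto|left; apply exp_pos]).
    assert (Eut : forall m, Iterm (wpow lam) a b c F n m = u m * t m).
    { intros m. unfold Iterm, u, t. destruct Z.eq_dec as [|Hm]; [ring|]. unfold wpow.
      rewrite <- !Rpower_Ropp. replace (- lam) with (- nu + (nu - lam)) by ring.
      rewrite Rpower_plus. ring. }
    assert (Eutp : forall m, g n m = u m * rpow (t m) p).
    { intros m. unfold g, Iterm, u, t. destruct Z.eq_dec as [|Hm]; [ring|]. unfold wpow.
      rewrite rpow_mult; [|auto|left; apply exp_pos]. fold (G (qform a b c m n)).
      rewrite (rpow_pos_eq (Rpower _ _)) by apply exp_pos.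
      rewrite Rpower_mult, <- !Rpower_Ropp.
      replace (- mu) with (- nu + (nu - lam) * p) by (unfold mu; ring).
      rewrite Rpower_plus. unfold G. ring. }
    rewrite <- (rpow_1 (rsymsum _ M)).
    2:{ rewrite rsymsum_lsum. apply lsum_nonneg. intros m _. apply Iterm_nonneg; auto. }
    replace 1 with (p * / p) by (field; lra).
    rewrite <- rpow_rpow.
    2:{ rewrite rsymsum_lsum. apply lsum_nonneg. intros m _. apply Iterm_nonneg; auto. }
    apply rpow_le; [lra|]. rewrite rsymsum_lsum, (lsum_ext _ _ _ (fun m _ => Eut m)).
    apply Rle_trans with (UC * lsum (fun m => u m * rpow (t m) p) (zlist M)).
    - apply jensen; auto. rewrite <- rsymsum_lsum. apply HUN.
    - rewrite <- (lsum_ext _ _ _ (fun m _ => Eutp m)), <- rsymsum_lsum.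
      apply Rmult_le_compat_l; [lra|apply HT]. }
  split.
  - intros n. now apply IopE_finite with (S n).
  - unfold lpnorm, lpnormE.
    destruct (sumZ_bounded (fun n => rpow (Cmod (Iop (wpow lam) a b c f n)) p) (A * Y))
      as (s & Es & Hs).
    + intros N. apply Rle_trans with (rsymsum (fun n => rpow 2 p * UC * T n) N).
      * apply rsymsum_le. intros n.
        apply Rle_trans with (rpow (2 * S n) p).
        -- apply rpow_le; [lra|]. apply Iop_bound; auto.
        -- rewrite rpow_mult by (try apply rpow_nonneg; lra).
           unfold S. rewrite rpow_rpow, Rinv_l, rpow_1 by (auto; lra). right. ring.
      * rewrite rsymsum_scal. unfold A. rewrite (Rmult_assoc _ C).
        apply Rmult_le_compat_l; [|auto].
        apply Rmult_le_pos; [apply rpow_nonneg|lra].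
    + change (exists x, Rbar_rpow (sumZ (fun n => Fin (rpow (Cmod (Iop (wpow lam) a b c f n)) p)))
                 (/ p) = Fin x /\ x <= rpow A (/ p) * rpow Y (/ p)).
      rewrite Es. exists (rpow s (/ p)). split; [reflexivity|].
      rewrite <- rpow_mult by easy. apply rpow_le; lra.
Qed.

(** * Sharpness for p > 1 *)

Lemma sumZ_PInf (g : Z -> R) :
  (forall B, exists N, B < rsymsum g N) -> sumZ (fun k => Fin (g k)) = PInf.
Proof.
  intros H. destruct (sumZ _) as [s|] eqn:E; [|reflexivity].
  destruct (H s) as [N HN]. assert (H1 := sumZ_upper g s N E). lra.
Qed.

Lemma sumZ_PInf_term (g : Z -> Rbar) (k : Z) : g k = PInf -> sumZ g = PInf.
Proof.
  intros H. apply Rbar_sup_PInf. exists (Z.to_nat (Z.abs k)).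
  assert (Hs : forall N, (Z.abs k <= Z.of_nat N)%Z -> symsum g N = PInf).
  { induction N as [|N IH]; intros HN; cbn [symsum].
    - replace 0%Z with k by lia. easy.
    - destruct (Z.eq_dec (Z.abs k) (Z.of_nat (S N))) as [E|E].
      + destruct (Z.eq_dec (Z.of_nat (S N)) k) as [->|E'].
        * rewrite H. destruct (symsum g N); reflexivity.
        * replace (- Z.of_nat (S N))%Z with k by lia. rewrite H.
          destruct (symsum g N), (g (Z.of_nat (S N))); reflexivity.
      + rewrite IH by lia. reflexivity. }
  symmetry. apply Hs. lia.
Qed.

Lemma nonsquare_8 : indef_nonsquare 1 0 (-2).
Proof.
  split; [reflexivity|]. intros [k Hk]. change (qdisc 1 0 (-2)) with 8%Z in Hk.
  destruct (Z.le_gt_cases (Z.abs k) 2); nia.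
Qed.

Lemma ln_diff_le (a b : R) : 0 < a -> 0 < b -> ln b - ln a <= b / a - 1.
Proof.
  intros Ha Hb. assert (Hq : 0 < b / a) by (now apply Rdiv_lt_0_compat).
  replace (ln b) with (ln a + ln (b / a)).
  - assert (H := exp_ineq1_le (ln (b / a))). rewrite exp_ln in H by easy. lra.
  - rewrite <- ln_mult by easy. f_equal. field. lra.
Qed.

(** The divergent counterpart of [sum_neg_power_bounded]: [d k / b k] is at least the increment of
    [log b]. It covers the harmonic series and the sum of [1 / (k (1 + log k))]. *)
Lemma log_sum_lower_bound (b d : nat -> R) (n : nat) :
  (forall k, (1 <= k)%nat -> 0 < b k) ->
  (forall k, (1 <= k)%nat -> b (S k) - b k <= d k) ->
  ln (b (S n)) - ln (b 1%nat) <= lsum (fun k => d k / b k) (seq 1 n).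
Proof.
  intros Hb Hd. induction n as [|n IH]; [simpl; lra|].
  rewrite seq_S, lsum_app. change (1 + n)%nat with (S n). set (k := S n) in *.
  assert (Hk : (1 <= k)%nat) by (unfold k; lia). clearbody k. cbn [lsum fold_right].
  assert (Hbk := Hb k Hk). assert (HbS := Hb (S k) ltac:(lia)).
  assert (H1 : ln (b (S k)) - ln (b k) <= b (S k) / b k - 1)
    by (now apply ln_diff_le).
  assert (H2 : b (S k) / b k - 1 <= d k / b k).
  { replace (b (S k) / b k - 1) with ((b (S k) - b k) / b k) by (field; lra).
    apply Rmult_le_compat_r; [left; now apply Rinv_0_lt_compat|auto]. }
  lra.
Qed.

Lemma log_sum_unbounded (b d : nat -> R) :
  (forall k, (1 <= k)%nat -> 0 < b k) ->
  (forall k, (1 <= k)%nat -> b (S k) - b k <= d k) ->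
  (forall x, exists n, x < b (S n)) ->
  forall B, exists n, B < lsum (fun k => d k / b k) (seq 1 n).
Proof.
  intros Hb Hd Hunb B. destruct (Hunb (exp (B + ln (b 1%nat)))) as [n Hn].
  exists n. assert (H := log_sum_lower_bound b d n Hb Hd).
  apply ln_increasing in Hn; [|apply exp_pos]. rewrite ln_exp in Hn. lra.
Qed.

Lemma INR_succ_unbounded (x : R) : exists n, x < INR (S n).
Proof. destruct (INR_unbounded x) as [n Hn]. exists n. rewrite S_INR. lra. Qed.

(** For [f = 1] the value of the operator at [n = 0] is twice the harmonic series. *)
Lemma linf_sharp : exists a b c : Z, indef_nonsquare a b c /\
  exists f : Z -> R, (forall k, 0 <= f k) /\
    lpnormE ExpInf (fun k => Fin (f k)) <> PInf /\
    lpnormE ExpInf (IopE (wpow 1) a b c f) = PInf.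
Proof.
  exists 1%Z, 0%Z, (-2)%Z. split; [apply nonsquare_8|].
  exists (fun _ => 1). split; [intros; lra|]. split.
  - destruct (Rbar_sup_bounded (fun x => exists k : Z, x = Fin 1) 1) as (s & Es & _).
    + exists 1, 0%Z. reflexivity.
    + intros [_ H]. discriminate.
    + intros x [_ H]. injection H as ->. lra.
    + unfold lpnormE. rewrite Es. discriminate.
  - apply Rbar_sup_PInf. exists 0%Z. symmetry. rewrite IopE_sumZ. apply sumZ_PInf.
    intros B. destruct (log_sum_unbounded INR (fun _ => 1)) with (B := B) as [n Hn].
    + intros k Hk. now apply lt_0_INR.
    + intros k _. rewrite S_INR. lra.
    + apply INR_succ_unbounded.
    + exists n. rewrite (rsymsum_even (fun k => 1 / INR k)); [|reflexivity| |].
      * assert (0 <= lsum (fun k => 1 / INR k) (seq 1 n)); [|lra].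
        apply lsum_nonneg. intros k Hk. apply in_seq in Hk.
        left. apply Rdiv_lt_0_compat; [lra|apply lt_0_INR; lia].
      * intros k Hk. unfold Iterm, wpow. destruct Z.eq_dec; [lia|].
        rewrite Z.abs_eq, <- INR_IZR_INZ, Rpower_1 by (try apply lt_0_INR; lia). reflexivity.
      * intros k Hk. unfold Iterm, wpow. destruct Z.eq_dec; [lia|].
        rewrite Z.abs_opp, Z.abs_eq, <- INR_IZR_INZ, Rpower_1 by (try apply lt_0_INR; lia).
        reflexivity.
Qed.

(** The index chosen for a point [k] of the support determines it, as [k = e (idx k)]; so the sum is
    reindexed injectively into an initial segment of the sum of [h]. *)
Lemma rsymsum_sparse (f : Z -> R) (e : nat -> Z) (h : nat -> R) (B : R) :
  (forall k, f k <> 0 -> exists j, (1 <= j)%nat /\ k = e j /\ f k <= h j) ->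
  (forall j, (1 <= j)%nat -> 0 <= h j) -> (forall n, lsum h (seq 1 n) <= B) ->
  forall N, rsymsum f N <= B.
Proof.
  intros Hf Hh HB N. rewrite rsymsum_lsum.
  set (t := fun k => negb (classical_eqb (f k) 0)).
  rewrite (lsum_filter_zero f t).
  2:{ intros k Hk. apply Bool.negb_false_iff in Hk. now apply classical_eqb_true. }
  set (L := filter t (zlist N)).
  assert (HL : forall k, In k L -> f k <> 0).
  { intros k Hk. apply filter_In in Hk. destruct Hk as [_ Hk]. intros E.
    unfold t in Hk. rewrite (proj2 (classical_eqb_true (f k) 0) E) in Hk. discriminate. }
  set (idx := fun k => epsilon (inhabits 0%nat) (fun j => (1 <= j)%nat /\ k = e j /\ f k <= h j)).
  assert (Hidx : forall k, In k L -> (1 <= idx k)%nat /\ k = e (idx k) /\ f k <= h (idx k)).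
  { intros k Hk.
    apply (epsilon_spec (inhabits 0%nat) (fun j => (1 <= j)%nat /\ k = e j /\ f k <= h j)).
    auto. }
  apply Rle_trans with (lsum h (map idx L)).
  - rewrite lsum_map. apply lsum_le. intros k Hk. now apply Hidx.
  - destruct (abs_bound_exists (fun k => Z.of_nat (idx k)) L) as [n Hn].
    apply Rle_trans with (2 := HB n). apply lsum_incl.
    + apply NoDup_map_NoDup_ForallPairs; [|apply NoDup_filter, NoDup_zlist].
      intros k k' Hk Hk' E. destruct (Hidx k Hk) as (_ & -> & _).
      destruct (Hidx k' Hk') as (_ & -> & _). now rewrite E.
    + intros j Hj. apply in_map_iff in Hj. destruct Hj as (k & <- & Hk).
      apply in_seq. specialize (Hn k Hk). destruct (Hidx k Hk). lia.
    + intros j Hj. apply in_seq in Hj. apply Hh. lia.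
Qed.

Lemma one_plus_ln_pos (k : nat) : (1 <= k)%nat -> 1 <= 1 + ln (INR k).
Proof.
  intros Hk. assert (H : 1 <= INR k) by apply (le_INR 1 k Hk).
  assert (0 <= ln (INR k)); [|lra]. rewrite <- ln_1.
  destruct H as [H| <-]; [left; apply ln_increasing; lra|lra].
Qed.

(** In [lp_sharp] the lower bound serves the convergence of the norm of [f], the upper bound the
    divergence of the operator. *)
Lemma ln_succ_diff (k : nat) : (1 <= k)%nat ->
  / INR (S k) <= ln (INR (S k)) - ln (INR k) <= / INR k.
Proof.
  intros Hk. assert (H0 : 0 < INR k) by (now apply lt_0_INR).
  assert (H1 : INR (S k) = INR k + 1) by apply S_INR.
  split.
  - assert (H := ln_diff_le (INR (S k)) (INR k) ltac:(lra) H0).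
    replace (INR k / INR (S k) - 1) with (- / INR (S k)) in H by (rewrite H1; field; lra). lra.
  - assert (H := ln_diff_le (INR k) (INR (S k)) H0 ltac:(lra)).
    replace (INR (S k) / INR k - 1) with (/ INR k) in H by (rewrite H1; field; lra). lra.
Qed.

(* Already [I f (0) = sum f(m^2) / |m|^(1 - 1/p)] diverges for
   [f(m^2) = m^(-1/p) / (1 + log m)]. *)
Lemma lp_sharp (p : R) : 1 < p -> exists a b c : Z, indef_nonsquare a b c /\
  exists f : Z -> R, (forall k, 0 <= f k) /\
    lpnormE (ExpFin p) (fun k => Fin (f k)) <> PInf /\
    lpnormE (ExpFin p) (IopE (wpow (1 - / p)) a b c f) = PInf.
Proof.
  intros Hp. exists 1%Z, 0%Z, (-2)%Z. split; [apply nonsquare_8|].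
  set (L := fun k : nat => 1 + ln (INR k)).
  assert (HL : forall k, (1 <= k)%nat -> 1 <= L k) by (intros; now apply one_plus_ln_pos).
  set (g := fun k : nat => Rpower (INR k) (- / p) / L k).
  assert (Hg : forall k, (1 <= k)%nat -> 0 < g k).
  { intros k Hk. apply Rdiv_lt_0_compat; [apply exp_pos|]. specialize (HL k Hk). lra. }
  (* The square 0 is excluded: the index [j = 0] is no point of the sequence. *)
  set (f := fun k : Z => if Z.eq_dec k 0 then 0 else
              if Z.eq_dec (Z.sqrt k * Z.sqrt k) k then g (Z.to_nat (Z.sqrt k)) else 0).
  assert (Hfsq : forall k, (1 <= k)%nat -> f (Z.of_nat k * Z.of_nat k)%Z = g k).
  { intros k Hk. unfold f. rewrite Z.sqrt_square by lia. destruct Z.eq_dec; [nia|].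
    destruct Z.eq_dec; [|easy]. now rewrite Nat2Z.id. }
  assert (Hf0 : forall k, f k <> 0 -> exists j, (1 <= j)%nat /\ k = (Z.of_nat j * Z.of_nat j)%Z).
  { intros k Hk. unfold f in Hk. destruct Z.eq_dec as [|H0]; [easy|].
    destruct Z.eq_dec as [E|]; [|easy]. exists (Z.to_nat (Z.sqrt k)).
    assert (Hs : (0 <= Z.sqrt k)%Z) by apply Z.sqrt_nonneg. split; [|lia].
    assert (Z.sqrt k <> 0)%Z by (intros E'; rewrite E' in E; lia). lia. }
  exists f. repeat split.
  - intros k. destruct (Req_dec (f k) 0) as [->|H]; [lra|].
    destruct (Hf0 k H) as (j & Hj & ->). rewrite Hfsq by easy. left; auto.
  (* Here [f(j^2)^p = 1 / (j (1 + log j)^p)], with [p] written as [1 + (p - 1)] for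
     [sum_neg_power_bounded]. *)
  - assert (Hsum : forall N, rsymsum (fun k => rpow (f k) p) N
       <= / INR 1 * Rpower (L 1%nat) (- (1 + (p - 1))) + / (p - 1) * Rpower (L 1%nat) (- (p - 1))).
    { apply (rsymsum_sparse _ (fun j => Z.of_nat j * Z.of_nat j)%Z
         (fun j => / INR j * Rpower (L j) (- (1 + (p - 1))))).
      - intros k Hk. destruct (Hf0 k) as (j & Hj & ->).
        { intros E. apply Hk. rewrite E. apply rpow_0. }
        exists j. repeat split; auto. rewrite Hfsq, rpow_pos_eq by auto. unfold g, Rdiv.
        specialize (HL j Hj). assert (Hj0 : 0 < INR j) by (now apply lt_0_INR).
        rewrite <- Rpower_mult_distr by (try apply exp_pos; apply Rinv_0_lt_compat; lra).
        rewrite Rpower_mult. replace (- / p * p) with (- (1)) by (field; lra).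
        rewrite (Rpower_Ropp (INR j)), Rpower_1 by easy.
        replace (1 + (p - 1)) with p by ring.
        rewrite <- (Rpower_1 (L j)) at 1 by lra.
        rewrite <- Rpower_Ropp, Rpower_mult. right. do 2 f_equal. ring.
      - intros j Hj. apply Rmult_le_pos; [|left; apply exp_pos].
        left. apply Rinv_0_lt_compat. now apply lt_0_INR.
      - intros n. apply (sum_neg_power_bounded L (fun k => / INR k)); [lra| | |].
        + intros k Hk. specialize (HL k Hk). lra.
        + intros k Hk. left. apply Rinv_0_lt_compat. now apply lt_0_INR.
        + intros k Hk. destruct (ln_succ_diff k Hk) as [H _]. unfold L. lra. }
    destruct (sumZ_bounded _ _ Hsum) as (s & Es & _). unfold lpnormE.
    change (Rbar_rpow (sumZ (fun k => Fin (rpow (f k) p))) (/ p) <> PInf). rewrite Es. discriminate.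
  - assert (H0 : IopE (wpow (1 - / p)) 1 0 (-2) f 0 = PInf).
    { rewrite IopE_sumZ. apply sumZ_PInf. intros B.
      destruct (log_sum_unbounded L (fun k => / INR k)) with (B := B) as [n Hn].
      - intros k Hk. specialize (HL k Hk). lra.
      - intros k Hk. destruct (ln_succ_diff k Hk) as [_ H]. unfold L. lra.
      - intros x. destruct (INR_succ_unbounded (exp x)) as [n Hn]. exists n.
        apply ln_increasing in Hn; [|apply exp_pos]. rewrite ln_exp in Hn. unfold L. lra.
      - exists n.
        assert (Hterm : forall k, (1 <= k)%nat -> g k * wpow (1 - / p) (Z.of_nat k) = / INR k / L k).
        { intros k Hk. specialize (HL k Hk). assert (Hk0 : 0 < INR k) by (now apply lt_0_INR).
          unfold wpow, g. rewrite Z.abs_eq, <- INR_IZR_INZ, <- Rpower_Ropp by lia.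
          replace (Rpower (INR k) (- / p) / L k * Rpower (INR k) (- (1 - / p)))
            with (Rpower (INR k) (- / p) * Rpower (INR k) (- (1 - / p)) / L k) by (field; lra).
          rewrite <- Rpower_plus. replace (- / p + - (1 - / p)) with (- (1)) by ring.
          rewrite Rpower_Ropp, Rpower_1 by easy. reflexivity. }
        rewrite (rsymsum_even (fun k => / INR k / L k)); [|reflexivity| |].
        + assert (0 <= lsum (fun k => / INR k / L k) (seq 1 n)); [|lra].
          apply lsum_nonneg. intros k Hk. apply in_seq in Hk.
          specialize (HL k ltac:(lia)). left.
          apply Rdiv_lt_0_compat; [apply Rinv_0_lt_compat, lt_0_INR; lia|lra].
        + intros k Hk. unfold Iterm. destruct Z.eq_dec; [lia|].
          replace (qform 1 0 (-2) (Z.of_nat k) 0) with (Z.of_nat k * Z.of_nat k)%Z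
            by (unfold qform; ring).
          now rewrite Hfsq, Hterm.
        + intros k Hk. unfold Iterm. destruct Z.eq_dec; [lia|].
          replace (qform 1 0 (-2) (- Z.of_nat k) 0) with (Z.of_nat k * Z.of_nat k)%Z
            by (unfold qform; ring).
          unfold wpow. rewrite Z.abs_opp. fold (wpow (1 - / p) (Z.of_nat k)).
          now rewrite Hfsq, Hterm. }
    unfold lpnormE. rewrite (sumZ_PInf_term _ 0%Z); [reflexivity|]. now rewrite H0.
Qed.

(** * Sharpness for p = 1 *)

(* [(m, n)] stands for [m + n sqrt 2]; this is multiplication by [1 + y sqrt 2]. *)
Definition mul_alpha (y : Z) (w : Z * Z) : Z * Z :=
  (fst w + 2 * y * snd w, snd w + y * fst w)%Z.

Lemma mul_alpha_comm (y y' : Z) (w : Z * Z) : mul_alpha y (mul_alpha y' w) = mul_alpha y' (mul_alpha y w).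
Proof. unfold mul_alpha. cbn [fst snd]. f_equal; ring. Qed.

Lemma iter_mul_alpha_comm (y y' : Z) (d e : nat) (w : Z * Z) :
  Nat.iter d (mul_alpha y) (Nat.iter e (mul_alpha y') w) = Nat.iter e (mul_alpha y') (Nat.iter d (mul_alpha y) w).
Proof.
  assert (H : forall e w, mul_alpha y (Nat.iter e (mul_alpha y') w) = Nat.iter e (mul_alpha y') (mul_alpha y w)).
  { clear. induction e as [|e IH]; intros w; [reflexivity|]. simpl. now rewrite mul_alpha_comm, IH. }
  induction d as [|d IH]; [reflexivity|]. simpl. now rewrite IH, H.
Qed.

(** The determinant [1 - 2 y^2] of this linear map is odd, hence nonzero. *)
Lemma mul_alpha_inj (y : Z) (w w' : Z * Z) : mul_alpha y w = mul_alpha y w' -> w = w'.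
Proof.
  destruct w as [m n], w' as [m' n']. intros E.
  assert (E1 : (m + 2 * y * n = m' + 2 * y * n')%Z) by exact (f_equal fst E).
  assert (E2 : (n + y * m = n' + y * m')%Z) by exact (f_equal snd E).
  assert (Hn : ((1 - 2 * (y * y)) * n = (1 - 2 * (y * y)) * n')%Z).
  { replace ((1 - 2 * (y * y)) * n)%Z with (n + y * m - y * (m + 2 * y * n))%Z by ring.
    rewrite E1, E2. ring. }
  assert (n = n') by (apply Z.mul_reg_l with (1 - 2 * (y * y))%Z; [lia|easy]).
  subst n'. f_equal. lia.
Qed.

Lemma iter_mul_alpha_inj (y : Z) (d : nat) (w w' : Z * Z) :
  Nat.iter d (mul_alpha y) w = Nat.iter d (mul_alpha y) w' -> w = w'.
Proof. induction d as [|d IH]; [easy|]. simpl. intros H. now apply IH, (mul_alpha_inj y). Qed.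

Definition norm2 (w : Z * Z) : Z := (fst w * fst w - 2 * (snd w * snd w))%Z.

Lemma norm2_iter (y : Z) (d : nat) (w : Z * Z) :
  norm2 (Nat.iter d (mul_alpha y) w) = ((1 - 2 * (y * y)) ^ Z.of_nat d * norm2 w)%Z.
Proof.
  induction d as [|d IH]; [simpl Z.of_nat; rewrite Z.pow_0_r; simpl Nat.iter; ring|].
  rewrite Nat2Z.inj_succ, Z.pow_succ_r, <- Z.mul_assoc, <- IH by lia. rewrite Nat.iter_succ.
  generalize (Nat.iter d (mul_alpha y) w). intros v. unfold norm2, mul_alpha. cbn [fst snd]. ring.
Qed.

Lemma dvd_power_coprime (n P : Z) (t : nat) :
  Z.gcd n P = 1%Z -> (n | P ^ Z.of_nat t)%Z -> (n | 1)%Z.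
Proof.
  intros Hg. induction t as [|t IH]; [easy|].
  rewrite Nat2Z.inj_succ, Z.pow_succ_r by lia. intros H. apply IH. now apply Z.gauss with P.
Qed.

Lemma coprime_of_combination (a b u v : Z) : (u * a + v * b = 1)%Z -> Z.gcd a b = 1%Z.
Proof.
  intros H. assert (Hd : (Z.gcd a b | 1)%Z).
  { rewrite <- H. apply Z.divide_add_r; apply Z.divide_mul_r;
      [apply Z.gcd_divide_l|apply Z.gcd_divide_r]. }
  apply Z.divide_1_r_nonneg in Hd; [easy|apply Z.gcd_nonneg].
Qed.

(* Reduction modulo [n = 1 - 2 y^2], with [sqrt 2] sent to [-2 y], kills [1 + y sqrt 2] and
   sends [1 - y sqrt 2] to the unit [2]. *)
Lemma mul_alpha_powers_distinct (y : Z) (d : nat) (w w' : Z * Z) :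
  (0 < d)%nat -> Nat.iter d (mul_alpha y) w = Nat.iter d (mul_alpha (- y)) w' ->
  (1 - 2 * (y * y) | norm2 w')%Z.
Proof.
  intros Hd E. set (n := (1 - 2 * (y * y))%Z).
  set (phi := fun w : Z * Z => (fst w - 2 * y * snd w)%Z).
  assert (H1 : (n | phi (Nat.iter d (mul_alpha y) w))%Z).
  { destruct d as [|d]; [lia|]. simpl. set (v := Nat.iter d (mul_alpha y) w). exists (fst v).
    unfold phi, mul_alpha, n. cbn [fst snd]. ring. }
  assert (H2 : forall d v, (n | phi (Nat.iter d (mul_alpha (- y)) v))%Z -> (n | phi v)%Z).
  { clear. induction d as [|d IH]; intros v H; [easy|]. apply IH. simpl in H.
    set (u := Nat.iter d (mul_alpha (- y)) v) in *.
    apply Z.gauss with (1 + 2 * (y * y))%Z.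
    - replace ((1 + 2 * (y * y)) * phi u)%Z
        with (phi (mul_alpha (- y) u) + (2 * y * snd u) * n)%Z
        by (unfold phi, mul_alpha, n; cbn [fst snd]; ring).
      apply Z.divide_add_r; [easy|]. apply Z.divide_mul_r, Z.divide_refl.
    - apply coprime_of_combination with (1 + y * y)%Z (y * y)%Z. unfold n. ring. }
  rewrite E in H1. apply H2 in H1.
  replace (norm2 w') with (phi w' * (fst w' + 2 * y * snd w') - 2 * (snd w' * snd w') * n)%Z
    by (unfold norm2, phi, n; ring).
  apply Z.divide_sub_r; [now apply Z.divide_mul_l|]. apply Z.divide_mul_r, Z.divide_refl.
Qed.

Lemma mul_alpha_bound (y X : Z) (w : Z * Z) :
  (Z.abs (fst w) <= X)%Z -> (Z.abs (snd w) <= X)%Z ->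
  (Z.abs (fst (mul_alpha y w)) <= (1 + 2 * Z.abs y) * X)%Z /\
  (Z.abs (snd (mul_alpha y w)) <= (1 + 2 * Z.abs y) * X)%Z.
Proof.
  intros H1 H2. unfold mul_alpha. cbn [fst snd].
  assert (Hy : forall v, (Z.abs v <= X -> Z.abs (y * v) <= Z.abs y * X)%Z).
  { intros v Hv. rewrite Z.abs_mul. apply Z.mul_le_mono_nonneg_l; lia. }
  assert (H3 := Hy _ H1). assert (H4 := Hy _ H2). split; [|lia].
  replace (2 * y * snd w)%Z with (2 * (y * snd w))%Z by ring. lia.
Qed.

Lemma iter_mul_alpha_bound (y X : Z) (d : nat) (w : Z * Z) :
  (Z.abs (fst w) <= X)%Z -> (Z.abs (snd w) <= X)%Z ->
  (Z.abs (fst (Nat.iter d (mul_alpha y) w)) <= (1 + 2 * Z.abs y) ^ Z.of_nat d * X)%Z /\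
  (Z.abs (snd (Nat.iter d (mul_alpha y) w)) <= (1 + 2 * Z.abs y) ^ Z.of_nat d * X)%Z.
Proof.
  intros H1 H2. induction d as [|d IH].
  - simpl Z.of_nat. rewrite Z.pow_0_r, Z.mul_1_l. easy.
  - rewrite Nat2Z.inj_succ, Z.pow_succ_r, <- Z.mul_assoc by lia.
    now apply mul_alpha_bound.
Qed.

(* The solutions are the products of [s] factors [alpha_i^e conj(alpha_i)^(t - e)], where
   [alpha_i = 1 + y_i sqrt 2] have pairwise coprime odd norms. *)
Lemma many_solutions (s : nat) :
  exists P B : Z, Z.odd P = true /\ ((0 < s)%nat -> (2 <= Z.abs P)%Z) /\ (1 <= B)%Z /\
    forall t : nat, exists l : list (Z * Z), NoDup l /\ length l = (S t ^ s)%nat /\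
      forall w, In w l -> norm2 w = (P ^ Z.of_nat t)%Z /\ (Z.abs (fst w) <= B ^ Z.of_nat t)%Z
                      /\ (Z.abs (snd w) <= B ^ Z.of_nat t)%Z.
Proof.
  induction s as [|s (P & B & Hodd & _ & HB & Hl)].
  - exists 1%Z, 1%Z. repeat split; try lia. intros t. exists [(1, 0)%Z].
    split; [constructor; [easy|constructor]|]. split; [reflexivity|].
    intros w [<-|[]]. rewrite Z.pow_1_l by lia. easy.
  (* This choice makes the new norm [n = 1 - 8 P^2] odd, coprime to [P], and of absolute value at
     least 7. *)
  - set (y := (2 * P)%Z). set (n := (1 - 2 * (y * y))%Z).
    assert (HP0 : P <> 0%Z) by (intros ->; discriminate).
    assert (HnP : (n = 1 - 8 * (P * P))%Z) by (unfold n, y; ring).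
    assert (HPP : (1 <= P * P)%Z) by nia.
    assert (Hn7 : (7 <= Z.abs n)%Z) by lia.
    exists (P * n)%Z, ((1 + 2 * Z.abs y) * B)%Z. repeat split.
    + rewrite Z.odd_mul, Hodd. replace n with (1 + 2 * (- 4 * (P * P)))%Z by lia.
      now rewrite Z.odd_add_mul_2.
    + intros _. rewrite Z.abs_mul. assert (1 <= Z.abs P)%Z by lia. nia.
    + nia.
    + intros t. destruct (Hl t) as (l & Hnd & Hlen & Hw).
      set (h := fun x : nat * (Z * Z) =>
        Nat.iter (fst x) (mul_alpha y) (Nat.iter (t - fst x) (mul_alpha (- y)) (snd x))).
      exists (map h (list_prod (seq 0 (S t)) l)).
      assert (Hin : forall x, In x (list_prod (seq 0 (S t)) l) ->
                (fst x <= t)%nat /\ In (snd x) l).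
      { intros [e w] Hx. apply in_prod_iff in Hx. rewrite in_seq in Hx. simpl. split; [lia|tauto]. }
      split; [|split].
      * apply NoDup_map_NoDup_ForallPairs; [|apply NoDup_list_prod; [apply seq_NoDup|easy]].
        (* Cancelling common factors leaves [alpha^d w = conj(alpha)^d w'] with [d = e' - e > 0].
           Then [n] would divide the norm [P^t] of [w'], to which it is coprime. *)
        assert (Hne : forall e e' w w', (e < e')%nat -> (e' <= t)%nat -> In w l -> In w' l ->
                  h (e', w) <> h (e, w')).
        { intros e e' w w' He He' Hwl Hwl' E. unfold h in E. cbn [fst snd] in E.
          set (d := (e' - e)%nat).
          assert (Hd : e' = (e + d)%nat) by (unfold d; lia).
          rewrite Hd, Nat.iter_add in E. apply iter_mul_alpha_inj in E.
          replace (t - e)%nat with (t - (e + d) + d)%nat in E by lia.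
          rewrite Nat.iter_add, iter_mul_alpha_comm in E. apply iter_mul_alpha_inj in E.
          apply mul_alpha_powers_distinct in E; [|unfold d; lia].
          destruct (Hw w' Hwl') as [Ew' _]. rewrite Ew' in E. fold n in E.
          apply dvd_power_coprime in E.
          - apply Z.divide_1_r in E. lia.
          - apply coprime_of_combination with 1%Z (8 * P)%Z. rewrite HnP. ring. }
        intros [e w] [e' w'] Hx Hx' E. destruct (Hin _ Hx) as [He Hwl], (Hin _ Hx') as [He' Hwl'].
        cbn [fst snd] in *. destruct (Nat.lt_trichotomy e e') as [H|[H|H]].
        -- exfalso. now apply (Hne e e' w' w).
        -- subst e'. unfold h in E. cbn [fst snd] in E.
           apply iter_mul_alpha_inj, iter_mul_alpha_inj in E. congruence.
        -- exfalso. now apply (Hne e' e w w').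
      * rewrite length_map, length_prod, length_seq, Hlen. reflexivity.
      * intros v Hv. apply in_map_iff in Hv. destruct Hv as ([e w] & <- & Hx).
        destruct (Hin _ Hx) as [He Hwl]. cbn [fst snd] in *. unfold h. cbn [fst snd].
        destruct (Hw w Hwl) as (Ew & B1 & B2). split.
        -- rewrite !norm2_iter, Ew. replace (1 - 2 * (- y * - y))%Z with n by (unfold n; ring).
           fold n. rewrite Z.mul_assoc, <- Z.pow_add_r by lia.
           replace (Z.of_nat e + Z.of_nat (t - e))%Z with (Z.of_nat t) by lia.
           rewrite Z.pow_mul_l. ring.
        -- replace (((1 + 2 * Z.abs y) * B) ^ Z.of_nat t)%Z with
             ((1 + 2 * Z.abs y) ^ Z.of_nat e *
               ((1 + 2 * Z.abs (- y)) ^ Z.of_nat (t - e) * B ^ Z.of_nat t))%Z.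
           2:{ rewrite Z.abs_opp, Z.mul_assoc, <- Z.pow_add_r by lia.
               replace (Z.of_nat e + Z.of_nat (t - e))%Z with (Z.of_nat t) by lia.
               now rewrite Z.pow_mul_l. }
           apply iter_mul_alpha_bound; now apply iter_mul_alpha_bound.
Qed.

(** Divergence can thus be shown by exhibiting finite lists of solutions with unbounded sums. The
    lists hold pairs [(m, n)] while the double sum runs over [n] first, whence the [swap]. *)
Lemma lsum_le_l1_norm (w : Z -> R) (a b c : Z) (f : Z -> R) :
  (forall m, 0 <= w m) -> (forall k, 0 <= f k) ->
  lpnormE (ExpFin 1) (IopE w a b c f) <> PInf ->
  exists V, forall l : list (Z * Z), NoDup l ->
    lsum (fun s => Iterm w a b c f (snd s) (fst s)) l <= V.
Proof.
  intros Hw Hf Hfin. unfold lpnormE in Hfin.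
  assert (Ht : forall n m, 0 <= Iterm w a b c f n m) by (intros; now apply Iterm_nonneg).
  assert (Hv : exists v : Z -> R, forall n, IopE w a b c f n = Fin (v n)).
  { exists (fun n => match IopE w a b c f n with Fin r => r | PInf => 0 end). intros n.
    destruct (IopE w a b c f n) as [r|] eqn:E; [reflexivity|].
    elim Hfin. rewrite (sumZ_PInf_term _ n); [reflexivity|]. now rewrite E. }
  destruct Hv as [v Hv].
  rewrite (sumZ_ext _ (fun n => Fin (rpow (v n) 1))) in Hfin by (intros n; now rewrite Hv).
  destruct (sumZ _) as [V|] eqn:EV; [|now elim Hfin]. exists V. intros l Hl.
  assert (Hvn : forall n M, rsymsum (Iterm w a b c f n) M <= v n).
  { intros n M. apply (sumZ_upper _ _ M). rewrite <- Hv. symmetry. apply IopE_sumZ. }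
  assert (Hv0 : forall n, 0 <= v n) by (intros n; apply Rle_trans with (2 := Hvn n 0%nat), Ht).
  set (swap := fun s : Z * Z => (snd s, fst s)).
  destruct (abs_bound_exists (@fst Z Z) l) as [M HM].
  destruct (abs_bound_exists (@snd Z Z) l) as [N HN].
  apply Rle_trans with
    (lsum (fun s => Iterm w a b c f (fst s) (snd s)) (list_prod (zlist N) (zlist M))).
  - apply Rle_trans with (lsum (fun s => Iterm w a b c f (fst s) (snd s)) (map swap l)).
    { rewrite lsum_map. right. reflexivity. }
    apply lsum_incl; auto.
    + apply Injective_map_NoDup; [|easy]. intros [x y] [x' y'] E. unfold swap in E.
      simpl in E. congruence.
    + intros s Hs. apply in_map_iff in Hs. destruct Hs as ([m n] & <- & Hs).
      apply in_prod_iff. split; apply in_zlist; [apply (HN _ Hs)|apply (HM _ Hs)].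
  - rewrite lsum_list_prod. apply Rle_trans with (2 := sumZ_upper _ _ N EV).
    rewrite rsymsum_lsum. apply lsum_le. intros n _. rewrite rpow_1 by auto.
    simpl. rewrite <- rsymsum_lsum. apply Hvn.
Qed.

(** At level [t] there are at least [t^(r+3)] solutions, each contributing at least
    [t^-2 (t Lam)^-r], where [Lam = log (1 + B)]. The total [t / Lam^r] is unbounded, which explains
    the exponent [r + 3]. *)
Lemma l1_sharp (r : nat) : exists a b c : Z, indef_nonsquare a b c /\
  exists f : Z -> R, (forall k, 0 <= f k) /\
    lpnormE (ExpFin 1) (fun k => Fin (f k)) <> PInf /\
    lpnormE (ExpFin 1) (IopE (wlog r) a b c f) = PInf.
Proof.
  exists 1%Z, 0%Z, (-2)%Z. split; [apply nonsquare_8|].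
  destruct (many_solutions (r + 3)) as (P & B & Hodd & HP & HB & Hl).
  specialize (HP ltac:(lia)).
  (* [P] may be negative, so absolute values are compared; [|P| >= 2] lets [t] be read off from
     [P^t], which makes [f] well defined. *)
  assert (Pinj : forall t t' : nat, (P ^ Z.of_nat t)%Z = (P ^ Z.of_nat t')%Z -> t = t').
  { intros t t' E. apply (f_equal Z.abs) in E. rewrite !Z.abs_pow in E.
    apply Z.pow_inj_r in E; lia. }
  set (Q := fun k t => (1 <= t)%nat /\ k = (P ^ Z.of_nat t)%Z).
  set (h := fun t : nat => 1 * Rpower (INR t) (- (1 + 1))).
  assert (Hh : forall t, (1 <= t)%nat -> 0 < h t).
  { intros t Ht. unfold h. rewrite Rmult_1_l. apply exp_pos. }
  set (f := fun k => match excluded_middle_informative (exists t, Q k t) with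
                     | left H => h (proj1_sig (constructive_indefinite_description _ H))
                     | right _ => 0 end).
  assert (HfP : forall t : nat, (1 <= t)%nat -> f (P ^ Z.of_nat t)%Z = h t).
  { intros t Ht. unfold f. destruct excluded_middle_informative as [H|H].
    - destruct (constructive_indefinite_description _ H) as (t' & Ht' & E). simpl.
      now rewrite (Pinj t t').
    - elim H. now exists t. }
  assert (Hf : forall k, f k <> 0 -> exists t, (1 <= t)%nat /\ k = (P ^ Z.of_nat t)%Z /\ f k <= h t).
  { intros k Hk. destruct (classic (exists t, Q k t)) as [(t & Ht & ->)|H].
    - exists t. rewrite HfP by easy. repeat split; auto. lra.
    - elim Hk. unfold f. now destruct excluded_middle_informative. }
  assert (Hf0 : forall k, 0 <= f k).
  { intros k. destruct (Req_dec (f k) 0) as [->|H]; [lra|].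
    destruct (Hf k H) as (t & Ht & -> & _). rewrite HfP by easy. left. auto. }
  assert (Hlog : forall m : Z, m <> 0%Z -> 0 < ln (1 + IZR (Z.abs m))).
  { intros m Hm. rewrite <- ln_1. apply ln_increasing; [lra|].
    assert (1 <= IZR (Z.abs m)) by (apply IZR_le; lia). lra. }
  assert (Hw : forall m, 0 <= wlog r m).
  (* At [m = 0] with [r > 0] the logarithm vanishes and the convention [/ 0 = 0] applies. *)
  { intros m. unfold wlog. destruct (Z.eq_dec m 0) as [->|Hm].
    - simpl Z.abs. rewrite Rplus_0_r, ln_1. destruct r as [|r].
      + simpl. lra.
      + rewrite pow_i by lia. rewrite Rinv_0. lra.
    - left. apply Rinv_0_lt_compat, pow_lt. auto. }
  exists f. repeat split; auto.
  - destruct (sumZ_bounded (fun k => rpow (f k) 1)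
      (1 * Rpower (INR 1) (- (1 + 1)) + / 1 * Rpower (INR 1) (- (1)))) as (s & Es & _).
    + apply (rsymsum_sparse _ (fun t => (P ^ Z.of_nat t)%Z) h).
      * intros k. rewrite rpow_1 by auto. apply Hf.
      * intros t Ht. left. auto.
      * intros n. apply (sum_neg_power_bounded INR (fun _ => 1)); try lra.
        -- intros k Hk. now apply lt_0_INR.
        -- intros; lra.
        -- intros k _. rewrite S_INR. lra.
    + unfold lpnormE. change (Rbar_rpow (sumZ (fun k => Fin (rpow (f k) 1))) (/ 1) <> PInf).
      rewrite Es. discriminate.
  - apply NNPP. intros Hfin.
    destruct (lsum_le_l1_norm (wlog r) 1 0 (-2) f Hw Hf0 Hfin) as [V HV].
    set (Lam := ln (1 + IZR (Z.abs B))). assert (HLam : 0 < Lam) by (apply Hlog; lia).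
    assert (HLr : 0 < Lam ^ r) by (now apply pow_lt).
    destruct (INR_succ_unbounded (V * Lam ^ r)) as [t0 Ht0]. set (t := S t0) in *.
    assert (Ht : 1 <= INR t) by (apply (le_INR 1); unfold t; lia).
    assert (Htr : 0 < INR t ^ r) by (apply pow_lt; lra).
    destruct (Hl t) as (l & Hnd & Hlen & Hsol). specialize (HV l Hnd).
    assert (Hterm : forall w, In w l ->
      / (INR t * INR t) * / (INR t ^ r * Lam ^ r) <= Iterm (wlog r) 1 0 (-2) f (snd w) (fst w)).
    { intros [m n] Hin. destruct (Hsol _ Hin) as (E & Hm & _). unfold norm2 in E.
      cbn [fst snd] in *.
      (* [m^2 - 2 n^2 = P^t] is odd, hence so is [m]. *)
      assert (Hm0 : m <> 0%Z).
      { intros ->. apply (f_equal Z.odd) in E. rewrite Z.odd_pow in E by (unfold t; lia).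
        rewrite Hodd in E. rewrite Z.odd_sub, !Z.odd_mul in E. discriminate. }
      unfold Iterm. destruct Z.eq_dec as [|_]; [contradiction|].
      replace (qform 1 0 (-2) m n) with (P ^ Z.of_nat t)%Z
        by (rewrite <- E; unfold qform; ring).
      rewrite HfP by (unfold t; lia).
      assert (Eh : h t = / (INR t * INR t)).
      { unfold h. rewrite Rpower_Ropp, Rpower_plus, Rpower_1 by lra. ring. }
      rewrite Eh. apply Rmult_le_compat_l.
      { left. apply Rinv_0_lt_compat. nra. }
      unfold wlog. assert (Hlm := Hlog m Hm0).
      apply Rinv_le_contravar; [now apply pow_lt|].
      rewrite <- Rpow_mult_distr. apply pow_incr. split; [lra|].
      unfold Lam. rewrite <- ln_pow.
      2:{ assert (0 <= IZR (Z.abs B)) by (apply IZR_le; lia). lra. }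
      (* [1 + |m| <= 1 + B^t <= (1 + B)^t], the second inequality because [t >= 1]. *)
      assert (Hle : 1 + IZR (Z.abs m) <= (1 + IZR (Z.abs B)) ^ t).
      { assert (HBp : forall k, 1 + IZR (Z.abs B) ^ S k <= (1 + IZR (Z.abs B)) ^ S k).
        { assert (HB1 : 1 <= IZR (Z.abs B)) by (apply IZR_le; lia).
          induction k as [|k IH]; [simpl; lra|].
          simpl in *. set (x := IZR (Z.abs B)) in *.
          assert (0 <= x * x ^ k) by (apply Rmult_le_pos; [lra|apply pow_le; lra]). nra. }
        apply Rle_trans with (2 := HBp t0). fold t. apply Rplus_le_compat_l.
        rewrite pow_IZR. apply IZR_le. rewrite (Z.abs_eq B) by lia. exact Hm. }
      destruct Hle as [Hle|Hle]; [|rewrite Hle; lra]. left. apply ln_increasing; [|easy].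
      assert (0 <= IZR (Z.abs m)) by (apply IZR_le; lia). lra. }
    assert (Hcount : INR t ^ r * (INR t * INR t * INR t) <= INR (length l)).
    { rewrite Hlen, pow_INR. apply Rle_trans with (INR t ^ (r + 3)).
      - rewrite pow_add. simpl. right. ring.
      - apply pow_incr. rewrite S_INR. lra. }
    assert (Hlow : INR t / Lam ^ r <= V).
    { apply Rle_trans with (2 := HV).
      apply Rle_trans with (lsum (fun _ => / (INR t * INR t) * / (INR t ^ r * Lam ^ r)) l);
        [|now apply lsum_le].
      rewrite lsum_const.
      replace (INR t / Lam ^ r) with (INR t ^ r * (INR t * INR t * INR t)
         * (/ (INR t * INR t) * / (INR t ^ r * Lam ^ r))) by (field; repeat split; lra).
      apply Rmult_le_compat_r; [|easy].
      left. apply Rmult_lt_0_compat; apply Rinv_0_lt_compat; [nra|].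
      now apply Rmult_lt_0_compat. }
    apply Rmult_le_compat_r with (r := Lam ^ r) in Hlow; [|lra].
    replace (INR t / Lam ^ r * Lam ^ r) with (INR t) in Hlow by (field; lra). lra.
Qed.

Theorem theorem2 :
  (forall (p : Exponent) (lam : R),
     0 < lam ->
     match p with
     | ExpFin p0 => 1 <= p0 /\ 1 - / p0 < lam
     | ExpInf => 1 < lam
     end ->
     forall D : Z, exists C : R, 0 <= C /\
       forall a b c : Z, indef_nonsquare a b c -> (qdisc a b c = D)%Z ->
       forall (f : Z -> Cx) (y : R), lpnorm p f = Fin y ->
         (forall n : Z, IopE (wpow lam) a b c (fun k => Cmod (f k)) n <> PInf) /\
         exists x : R, lpnorm p (Iop (wpow lam) a b c f) = Fin x /\ x <= C * y)
  /\
  (forall r : nat, (1 <= r)%nat ->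
     exists a b c : Z, indef_nonsquare a b c /\
       exists f : Z -> R, (forall k, 0 <= f k) /\
         lpnormE (ExpFin 1) (fun k => Fin (f k)) <> PInf /\
         lpnormE (ExpFin 1) (IopE (wlog r) a b c f) = PInf)
  /\
  (forall p : R, 1 < p ->
     exists a b c : Z, indef_nonsquare a b c /\
       exists f : Z -> R, (forall k, 0 <= f k) /\
         lpnormE (ExpFin p) (fun k => Fin (f k)) <> PInf /\
         lpnormE (ExpFin p) (IopE (wpow (1 - / p)) a b c f) = PInf)
  /\
  (exists a b c : Z, indef_nonsquare a b c /\
       exists f : Z -> R, (forall k, 0 <= f k) /\
         lpnormE ExpInf (fun k => Fin (f k)) <> PInf /\
         lpnormE ExpInf (IopE (wpow 1) a b c f) = PInf).
Proof.
  repeat split.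
  - intros p lam _ Hp D.
    destruct (classic ((0 < D)%Z /\ ~ (exists k, (k * k)%Z = D))) as [[HD Hns]|HD].
    + destruct p as [p|].
      * destruct (bounded_lp p lam D (proj1 Hp) (proj2 Hp) HD Hns) as (C & HC & H).
        exists C. split; [easy|]. intros a b c _ Hdisc f y. now apply H.
      * destruct (bounded_linf lam Hp) as (C & HC & H).
        exists C. split; [easy|]. intros a b c _ _ f y. now apply H.
    (* No admissible form has such a discriminant, so the claim is vacuous for this [D]. *)
    + exists 0. split; [lra|]. intros a b c [H1 H2] <-. now elim HD.
  - intros r _. apply l1_sharp.
  - apply lp_sharp.
  - apply linf_sharp.
Qed.
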